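(* For each of the following spaces $X$, the only group topology on $H(X)$ contained in both the topology of pointwise convergence $\tau_p$ and the compact-open topology $\tau_k$ is the indiscrete topology. In particular, $H(X)$ does not have a minimum Hausdorff group topology. The spaces are: (a) every compact manifold (without boundary) of dimension at least $2$; (b) the Cantor set; and (c) the Hilbert cube.
   Context: $H(X)$ denotes the group of all homeomorphisms of $X$ onto itself under composition, with identity $1$. A topology on a group is a group topology if the group operations are continuous for it (it need not be Hausdorff). A minimum Hausdorff group topology on a group $G$ is a Hausdorff group topology on $G$ contained in every Hausdorff group topology on $G$. For a compact metric space $(X,d)$: $\tau_p$ is the topology on $H(X)$ whose basic neighborhoods of $1$ are the sets $\{f\in H(X): f(x)=x \text{ for all } x\in F\}$, for $F$ a finite subset of $X$; $\tau_k$ is the compact-open topology on $H(X)$, whose basic neighborhoods of $1$ are the sets $\{f\in H(X): d(f(x),x)<\epsilon\text{ for all }x\in X\}$, for $\epsilon>0$.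
   Formalization: In (a), compact manifolds are taken to be connected and nonempty: for two disjoint copies of a sphere, the homeomorphisms preserving each copy give a non-indiscrete group topology contained in both, and for empty X the trivial group has a minimum Hausdorff group topology. *)

(* Defs.v *)
From HB Require Import structures.
From mathcomp Require Import all_boot all_order all_algebra.
From mathcomp Require Import ring lra.
From mathcomp Require Import all_classical all_reals all_analysis.
Import Order.TTheory GRing.Theory Num.Theory.
Import numFieldNormedType.Exports.

Set Implicit Arguments.
Unset Strict Implicit.
Unset Printing Implicit Defensive.

Local Open Scope classical_set_scope.
Local Open Scope ring_scope.

Definition homeomorphism (X Y : topologicalType) (f : X -> Y) : Prop :=
  continuous f /\
  exists g : Y -> X, [/\ continuous g, cancel f g & cancel g f].

Definition homeomorphic (X Y : topologicalType) : Prop :=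
  exists f : X -> Y, homeomorphism f.

Record homeo (X : topologicalType) := Homeo {
  homeo_fun :> X -> X;
  homeoP : homeomorphism homeo_fun }.

Lemma homeo_ext (X : topologicalType) (f g : homeo X) : f =1 g -> f = g.
Proof.
case: f g => [f hf] [g hg] /= /funext fg; case: _ / fg in hg *.
by congr Homeo; exact: Prop_irrelevance.
Qed.

Section homeo_group.
Context {X : topologicalType}.
Implicit Types f g : homeo X.

Lemma homeo_one_subproof : homeomorphism (@idfun X).
Proof. by split=> [x //|]; exists idfun; split=> // x. Qed.

Definition homeo_one := Homeo homeo_one_subproof.

Lemma homeo_mul_subproof f g : homeomorphism (f \o g).
Proof.
case: f g => [f [cf [f' [cf' fK f'K]]]] [g [cg [g' [cg' gK g'K]]]] /=.
split=> [x|]; first by apply: continuous_comp; [exact: cg|exact: cf].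
exists (g' \o f'); split; [|exact: can_comp|exact: can_comp].
by move=> x; apply: continuous_comp; [exact: cf'|exact: cg'].
Qed.

Definition homeo_mul f g := Homeo (homeo_mul_subproof f g).

Definition homeo_invfun f : X -> X := projT1 (cid (homeoP f).2).

Lemma homeo_invfunP f :
  [/\ continuous (homeo_invfun f), cancel f (homeo_invfun f)
    & cancel (homeo_invfun f) f].
Proof. by rewrite /homeo_invfun; case: cid. Qed.

Lemma homeo_inv_subproof f : homeomorphism (homeo_invfun f).
Proof.
by case: (homeo_invfunP f) => c k k'; split=> //; exists f; split=> //;
  case: (homeoP f).
Qed.

Definition homeo_inv f := Homeo (homeo_inv_subproof f).

Lemma homeo_mulA : associative homeo_mul.
Proof. by move=> f g h; exact: homeo_ext. Qed.
Lemma homeo_mul1 : left_id homeo_one homeo_mul.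
Proof. by move=> f; exact: homeo_ext. Qed.
Lemma homeo_1mul : right_id homeo_one homeo_mul.
Proof. by move=> f; exact: homeo_ext. Qed.
Lemma homeo_mulV : left_inverse homeo_one homeo_inv homeo_mul.
Proof. by move=> f; apply: homeo_ext; case: (homeo_invfunP f). Qed.
Lemma homeo_Vmul : right_inverse homeo_one homeo_inv homeo_mul.
Proof. by move=> f; apply: homeo_ext; case: (homeo_invfunP f). Qed.

End homeo_group.

HB.instance Definition _ (X : topologicalType) := gen_eqMixin (homeo X).
HB.instance Definition _ (X : topologicalType) := gen_choiceMixin (homeo X).
HB.instance Definition _ (X : topologicalType) :=
  isGroup.Build (homeo X) homeo_mulA homeo_mul1 homeo_1mul homeo_mulV
    homeo_Vmul.

(* A topology on G is a structure [t : Topological G], as in [sup_topology]; *)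
(* it turns G into the topological space [Topological.Pack t].               *)
Definition opens (G : Type) (t : Topological G) : set (set G) :=
  @open (Topological.Pack t).

Definition is_indiscrete (G : Type) (t : Topological G) : Prop :=
  opens t = [set set0; setT].

Definition is_group_topology (G : groupType) (t : Topological G) : Prop :=
  let T := Topological.Pack t in
  continuous (fun p : T * T => (p.1 : G) * (p.2 : G) : T)%g /\
  continuous (fun x : T => (x : G)^-1 : T)%g.

Definition is_hausdorff_group_topology (G : groupType) (t : Topological G) :
    Prop :=
  is_group_topology t /\ hausdorff_space (Topological.Pack t).

Definition is_minimum_hausdorff_group_topology (G : groupType)
    (t : Topological G) : Prop :=
  is_hausdorff_group_topology t /\
  forall s : Topological G,
    is_hausdorff_group_topology s -> opens t `<=` opens s.

Section tau_p.
Context {X : topologicalType}.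

Definition pointwise_stab (F : set X) : set (homeo X) :=
  [set f | forall x, F x -> f x = x].

(* Basic neighborhoods of f are the translates f * pointwise_stab F; see      *)
(* [tau_p_nbhs1] and [tau_k_nbhs1] for those of 1.                            *)
Definition tau_p_open : set (set (homeo X)) :=
  [set U | forall f, U f -> exists2 F : set X, finite_set F &
    forall h, pointwise_stab F h -> U (f * h)%g].

Lemma tau_p_openT : tau_p_open setT.
Proof. by move=> f _; exists set0. Qed.

Lemma tau_p_openI : setI_closed tau_p_open.
Proof.
move=> U V oU oV f [/oU[F fF FU] /oV[E fE EV]].
exists (F `|` E); first by rewrite finite_setU.
by move=> h hFE; split; [apply: FU|apply: EV] => x ?; apply: hFE; [left|right].
Qed.

Lemma tau_p_open_bigU (I : Type) (U : I -> set (homeo X)) :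
  (forall i, tau_p_open (U i)) -> tau_p_open (\bigcup_i U i).
Proof.
by move=> oU f [i _ /oU[F fF FU]]; exists F => // h hF; exists i => //; exact: FU.
Qed.

End tau_p.

Definition homeo_pw (X : topologicalType) : Type := homeo X.
HB.instance Definition _ (X : topologicalType) := Choice.on (homeo_pw X).
HB.instance Definition _ (X : topologicalType) :=
  isOpenTopological.Build (homeo_pw X) tau_p_openT tau_p_openI
    (@tau_p_open_bigU X).

Definition tau_p (X : topologicalType) : Topological (homeo X) :=
  Topological.class (homeo_pw X).

Definition tau_k (X : topologicalType) : Topological (homeo X) :=
  Topological.class
    (initial_topology (fun f : homeo X => (f : X -> X) : {compact-open, X -> X})).

(* Manifolds are connected and nonempty: if two components of X are           *)
(* homeomorphic, the homeomorphisms mapping each component to itself form a   *)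
(* proper normal subgroup, open in both tau_p X and tau_k X.                  *)
Definition compact_manifold (R : realType) (n : nat) (X : topologicalType) :
    Prop :=
  [/\ [set: X] !=set0, connected [set: X], compact [set: X],
      hausdorff_space X /\ @second_countable X &
      forall x : X, exists (U : set X) (V : set 'rV[R]_n),
        [/\ open U, U x, open V & homeomorphic U V]].

Definition hilbert_cube (R : realType) : topologicalType :=
  prod_topology (fun _ : nat => set_type [set` `[0, 1]%R : interval R]).

Lemma tau_p_nbhs1 (X : topologicalType) (A : set (homeo X)) :
  nbhs ((1%g : homeo X) : Topological.Pack (tau_p X)) A <->
  exists2 F : set X, finite_set F & pointwise_stab F `<=` A.
Proof.
rewrite nbhsE; split=> [[U [oU U1] UA]|[F fF FA]].
  case: (oU _ U1) => F fF FU; exists F => // h /FU.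
  by rewrite mul1g => /UA.
exists (pointwise_stab F); last exact: FA.
split; last by move=> x _.
by move=> f Ff; exists F => // h Fh x Fx /=; rewrite Fh// Ff.
Qed.

Lemma tau_k_nbhs1 (R : realType) (X : metricType R) (A : set (homeo X)) :
  compact [set: X] ->
  nbhs ((1%g : homeo X) : Topological.Pack (tau_k X)) A <->
  exists2 e : R, 0 < e &
    [set f : homeo X | forall x, mdist (f x) x < e] `<=` A.
Proof.
move=> cX; split=> [|[e e0 eA]].
  rewrite nbhsE => -[_ [[U oU <-] U1] UA].
  pose N (e : R) := [set f : homeo X | forall x, mdist (f x) x < e].
  pose F := filter_from [set e : R | 0 < e] N.
  have FF : Filter F.
    apply: filter_from_filter; first by exists 1 => /=.
    move=> a b /= a0 b0; exists (Num.min a b) => /=.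
      by rewrite lt_min a0.
    by move=> f Nf; split=> x; have := Nf x; rewrite lt_min => /andP[].
  have : fmap (fun f : homeo X => (f : X -> X) : {compact-open, X -> X}) F
      --> (idfun : {compact-open, X -> X}).
    apply/compact_open_cvgP => K O cK oO KO.
    have /compact_near_coveringP/(_ R (0^'+) (fun d y => ball y d `<=` O)) := cK.
    case=> [x Kx|d /= d0 dO].
      have : nbhs x O.
        by apply: open_nbhs_nbhs; split=> //; apply: KO; exists x.
      move=> /nbhs_ballP[r /= r0 rO].
      exists (ball x (r / 2), [set d | d < r / 2]) => /=.
        split; first by apply: nbhsx_ballx; rewrite divr_gt0.
        by apply: nbhs_right_lt; rewrite divr_gt0.
      move=> [y d] /= [xy dr] z yz; apply: rO.
      rewrite (splitr r); apply: (ball_triangle xy).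
      exact: le_ball (ltW dr) _ yz.
    exists (d / 2) => /=; first by rewrite divr_gt0.
    move=> f Nf _ [y Ky <-]; apply: (dO (d / 2) _ _ y Ky).
    - by rewrite /ball /= sub0r normrN gtr0_norm ?divr_gt0// ltr_pdivrMr// ltr_pMr// ltr1n.
    - by rewrite /= divr_gt0.
    - by rewrite ballEmdist /= metric_sym.
  have nU : nbhs (idfun : {compact-open, X -> X}) U.
    by apply: open_nbhs_nbhs; split.
  by move=> /(_ _ nU)[e /= e0 eU]; exists e => // f /eU /UA.
apply: (@filterS _ _ _ [set f : homeo X | [set: X] `<=` [set x | mdist (f x) x < e]]).
  by move=> f fe; apply: eA => x; exact: fe.
have /compact_near_coveringP/(_ (homeo X)
  (nbhs ((1%g : homeo X) : Topological.Pack (tau_k X)))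
  (fun f x => mdist (f x) x < e)) := cX.
apply=> x _.
pose C := closure (ball x (e / 4)).
have e4 : 0 < e / 4 by rewrite divr_gt0.
have e2 : 0 < e / 2 by rewrite divr_gt0.
have Cx : C `<=` (ball x (e / 2))°.
  move=> y /(_ (ball y (e / 8))) [|z [xz yz]].
    by apply: nbhsx_ballx; rewrite divr_gt0.
  apply/nbhs_ballP; exists (e / 8) => /=; first by rewrite divr_gt0.
  move=> w yw; have -> : e / 2 = e / 4 + e / 8 + e / 8 by field.
  by apply: ball_triangle yw; apply: ball_triangle xz _; exact: ball_sym.
have cC : compact C.
  by apply: (subclosed_compact _ cX) => //; exact: closed_closure.
exists (C, [set f : homeo X | f @` C `<=` (ball x (e / 2))°]) => /=.
  split.
    apply: (@filterS _ _ _ (ball x (e / 4))); first exact: subset_closure.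
    exact: nbhsx_ballx.
  apply: (@open_nbhs_nbhs (Topological.Pack (tau_k X)) (1%g : homeo X)).
  split; last by move=> _ [y Cy <-]; exact: Cx.
  exists [set g : X -> X | g @` C `<=` (ball x (e / 2))°] => //.
  by apply: compact_open_open => //; exact: open_interior.
move=> [y f] /= [Cy fC].
have /interior_subset xy := Cx _ Cy.
have /interior_subset xfy : (ball x (e / 2))° (f y) by apply: fC; exists y.
have : ball (f y) (e / 2 + e / 2) y.
  by apply: ball_triangle xy; exact: ball_sym.
by rewrite -splitr ballEmdist.
Qed.

(* Main.v *)
Require Import Defs.
From mathcomp Require Import all_boot all_order all_algebra.
From mathcomp Require Import ring lra.
From mathcomp Require Import all_classical all_reals all_analysis.
Import Order.TTheory GRing.Theory Num.Theory.
Import numFieldNormedType.Exports.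

Set Implicit Arguments.
Unset Strict Implicit.
Unset Printing Implicit Defensive.

Local Open Scope classical_set_scope.
Local Open Scope ring_scope.

(** Let [t] be a group topology coarser than both [tau_p] and [tau_k], let [g]
    be a homeomorphism and [V] a [t]-neighborhood of 1.  Since [t] is coarser
    than [tau_p], [V] contains the pointwise stabilizer of a finite set [F];
    since it is coarser than [tau_k], [V] contains all homeomorphisms
    sufficiently close to 1.  Take [h] close to 1 that moves [F] off both [F]
    and [g F].  If some [k] fixes [h F] pointwise and agrees with [g] on [F],
    then [g = h (h^-1 k h) h^-1 (k^-1 g)], where [h^-1 k h] and [k^-1 g] fix [F]
    pointwise.  So every [g] is a product of four elements of [V] and of
    inverses of elements of [V], with a word that depends on neither [V] nor
    [g]; by continuity of the group operations, every nonempty [t]-open set is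
    everything ([pointwise_compact_open_indiscrete]).  A minimum Hausdorff group
    topology would be coarser than [tau_p] and [tau_k], which are Hausdorff group
    topologies, hence would be indiscrete and Hausdorff on a nontrivial group.

    Two properties of [X] are used: [finitely_displaceable], which provides [h],
    and [finitely_homogeneous], which provides [k] by moving the points of [F]
    one at a time.  They are established as follows.

    For a manifold, a bump function in a chart gives homeomorphisms of small
    support that move a given point to any nearby point
    ([manifold_locally_movable]); homeomorphisms of small support are close to 1,
    which yields [h].  The orbits of the stabilizer of a finite set [D] on the
    complement of [D] are therefore open, and this complement is connected
    because small punctured balls are connected in dimension at least 2; so
    there is only one orbit ([manifold_homogeneous]).

    For the Cantor set, adding the sequence [x + y] modulo 2 on two small
    cylinders around [x] and [y] swaps [x] and [y] ([cantor_swap]).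

    For the Hilbert cube, homeomorphisms that only change coordinates of large
    index are close to 1, and the remaining coordinates again form a Hilbert
    cube, so that homogeneity yields [h].  For homogeneity, points with all
    coordinates in the open interval are moved by Moebius maps of the
    coordinates whose parameters are functions of other coordinates that vanish
    on [D] ([slide]).  An arbitrary point is first pushed into this
    pseudo-interior by an infinite composition of homeomorphisms of squares
    ([to_pseudo_interior]): the one acting on the coordinates [n] and [n+1]
    turns the boundary of the square a little, so that a boundary value moves
    from coordinate [n] to coordinate [n+1], and on to infinity. *)

(** * The compact-open and pointwise topologies on the homeomorphism group *)

Section tau_k_theory.
Context {X : topologicalType}.
Implicit Types f g h : homeo X.
Local Notation Hk := (Topological.Pack (tau_k X)).

Lemma homeo_continuous f : continuous f.
Proof. by case: (homeoP f). Qed.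

Lemma homeoK f : cancel f (f^-1)%g.
Proof. by have [_ fK _] := homeo_invfunP f. Qed.

Lemma homeoVK f : cancel (f^-1)%g f.
Proof. by have [_ _ fVK] := homeo_invfunP f. Qed.

Lemma homeo_inj f : injective f.
Proof. exact: can_inj (homeoK f). Qed.

Lemma tau_k_compact_openP (F : set_system (homeo X)) f : Filter F ->
  F --> (f : Hk) <->
  forall K O, compact K -> open O -> f @` K `<=` O ->
    F [set g : homeo X | g @` K `<=` O].
Proof.
move=> FF; split=> [Ff K O cK oO KO|FKO A].
  apply: Ff; apply: (@open_nbhs_nbhs Hk); split=> //.
  by exists [set g : X -> X | g @` K `<=` O] => //; exact: compact_open_open.
rewrite nbhsE => -[_ [[B oB <-] Bf] BA]; apply: filterS BA _.
have FfB : fmap (fun g : homeo X => (g : X -> X) : {compact-open, X -> X}) F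
    --> ((f : X -> X) : {compact-open, X -> X}).
  by apply/compact_open_cvgP => K O cK oO KO; exact: FKO.
by apply: FfB; apply: open_nbhs_nbhs; split.
Qed.

Hypotheses (cX : compact [set: X]) (hX : hausdorff_space X).

(** Convergence in the compact-open topology is continuous convergence.  In this
    form smallness of homeomorphisms can be checked one point at a time. *)
Lemma tau_k_cvgP (F : set_system (homeo X)) f : Filter F ->
  F --> (f : Hk) <->
  forall x, (fun p : X * homeo X => p.2 p.1) @ filter_prod (nbhs x) F
    --> f x.
Proof.
move=> FF; rewrite tau_k_compact_openP; split=> [FKO x A|Fx K O cK oO KO].
  rewrite nbhsE => -[ O [oO Ofx] OA].
  have [B Bx BO] : filter_from (nbhs x) closure (f @^-1` O).
    apply: (compact_regular hX cX); first exact: filterT.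
    exact: homeo_continuous (open_nbhs_nbhs (conj oO Ofx)).
  exists (B, [set g : homeo X | g @` closure B `<=` O]) => /=.
    split=> //=; apply: FKO => //.
    - by apply: (subclosed_compact _ cX) => //; exact: closed_closure.
    - by move=> _ [y /BO Oy <-].
  move=> [y g] /= [By gB]; apply: OA; apply: gB; exists y => //.
  exact: subset_closure.
apply: (@filterS _ _ _ [set g : homeo X | K `<=` [set x | O (g x)]]).
  by move=> g gO _ [x Kx <-]; exact: gO.
have /compact_near_coveringP/(_ _ F (fun g x => O (g x))) := cK.
apply=> x Kx; apply: Fx; apply: open_nbhs_nbhs; split=> //; apply: KO.
by exists x.
Qed.

(** For the inverse: [h^-1] maps [K] into [O] exactly when [h] maps the compact
    complement of [O] into the open complement of [K]. *)
Lemma tau_k_group_topology : is_group_topology (tau_k X).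
Proof.
split=> [[f g]|f].
  apply/tau_k_cvgP => x A /= Afgx.
  have /tau_k_cvgP/(_ (g x) _ Afgx) [[B C] /= [Bgx Cf] BCA] :
    nbhs (f : Hk) --> (f : Hk) by exact: cvg_id.
  have /tau_k_cvgP/(_ x _ Bgx) [[D E] /= [Dx Eg] DEB] :
    nbhs (g : Hk) --> (g : Hk) by exact: cvg_id.
  exists (D, [set h | exists2 k, C k & exists2 l, E l & h = k * l]%g) => /=.
    split=> //; exists (C, E) => //= -[k l] /= [Ck El].
    by exists k => //; exists l.
  move=> [y _] /= [Dy [k Ck [l El ->]]].
  by apply: (BCA (l y, k)); split=> //; exact: (DEB (y, l)).
have FF : Filter ((fun x : Hk => (x^-1)%g : Hk) @ nbhs (f : Hk)).
  exact: fmap_filter.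
apply/(tau_k_compact_openP _ FF) => K O cK oO KO.
have /tau_k_compact_openP/(_ (~` O) (~` K)) : nbhs (f : Hk) --> (f : Hk).
  exact: cvg_id.
have cO : compact (~` O).
  by apply: (subclosed_compact _ cX) => //; exact: open_closedC.
have oK : open (~` K) by apply: closed_openC; exact: compact_closed.
move=> /(_ cO oK) fOK.
apply: filterS (fOK _).
  move=> h hOK _ [x Kx <-]; apply: contrapT => nO.
  by apply: (hOK (h ((h^-1)%g x))); [exists ((h^-1)%g x)|rewrite homeoVK].
move=> _ [x nOx <-] Kfx; apply: nOx; apply: KO; exists (f x) => //.
exact: homeoK.
Qed.

Lemma tau_k_hausdorff : hausdorff_space Hk.
Proof.
move=> f g clfg; apply: homeo_ext => x; apply: hX => A B Afx Bgx.
move: (clfg [set h : homeo X | A (h x)] [set h : homeo X | B (h x)]) => /=.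
have ev (h : homeo X) C : nbhs (h x) C ->
    nbhs (h : Hk) [set k : homeo X | C (k x)].
  have /tau_k_cvgP/(_ x) hh : nbhs (h : Hk) --> (h : Hk) by exact: cvg_id.
  move=> /hh[[D E] /= [Dx Eh] DE].
  apply: filterS Eh => k Ek; apply: (DE (x, k)); split=> //.
  exact: nbhs_singleton.
by move=> /(_ (ev _ _ Afx) (ev _ _ Bgx)) [h [Ah Bh]]; exists (h x).
Qed.

End tau_k_theory.

Section tau_p_theory.
Context {X : topologicalType}.
Implicit Types f g h : homeo X.
Local Notation Hp := (Topological.Pack (tau_p X)).

Lemma homeoM f g x : (f * g)%g x = f (g x).
Proof. by []. Qed.

Lemma pointwise_stab1 (F : set X) : pointwise_stab F 1%g.
Proof. by []. Qed.

Lemma pointwise_stabM (F : set X) f g :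
  pointwise_stab F f -> pointwise_stab F g -> pointwise_stab F (f * g)%g.
Proof. by move=> Ff Fg x Fx; rewrite homeoM Fg// Ff. Qed.

Lemma pointwise_stabV (F : set X) f :
  pointwise_stab F f -> pointwise_stab F (f^-1)%g.
Proof. by move=> Ff x Fx; rewrite -{1}(Ff x Fx) homeoK. Qed.

Lemma pointwise_stab_conj (F : set X) f g :
  pointwise_stab (g @` F) f -> pointwise_stab F (g^-1 * f * g)%g.
Proof. by move=> Ff x Fx; rewrite !homeoM Ff ?homeoK//; exists x. Qed.

Lemma tau_p_nbhsP f (A : set (homeo X)) :
  nbhs (f : Hp) A <->
  exists2 F : set X, finite_set F &
    forall h, pointwise_stab F h -> A (f * h)%g.
Proof.
rewrite nbhsE; split=> [[U [oU Uf] UA]|[F fF FA]].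
  by case: (oU _ Uf) => F fF FU; exists F => // h /FU/UA.
exists [set g | exists2 h, pointwise_stab F h & g = (f * h)%g].
  split; last by exists 1%g; rewrite ?mulg1.
  move=> g [h Fh ->]; exists F => // k Fk.
  by exists (h * k)%g; rewrite ?mulgA//; exact: pointwise_stabM.
by move=> _ [h Fh ->]; exact: FA.
Qed.

Lemma tau_p_group_topology : is_group_topology (tau_p X).
Proof.
split=> [[f g]|f] A /tau_p_nbhsP[F fF FA].
  exists ([set k | exists2 h, pointwise_stab (g @` F) h & k = (f * h)%g],
          [set k | exists2 h, pointwise_stab F h & k = (g * h)%g]) => /=.
    split; apply/tau_p_nbhsP.
      by exists (g @` F); [exact: finite_image|move=> h gFh; exists h].
    by exists F => // h Fh; exists h.
  move=> [_ _] /= [[u gFu ->] [v Fv ->]].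
  have -> : (f * u * (g * v) = f * g * ((g^-1 * u * g) * v))%g.
    by rewrite !mulgA mulgK.
  by apply: FA; apply: pointwise_stabM => //; exact: pointwise_stab_conj.
apply/tau_p_nbhsP; exists ((f^-1)%g @` F); first exact: finite_image.
move=> h Fh; rewrite /= invgM.
have -> : (h^-1 * f^-1 = f^-1 * (f^-1^-1 * h^-1 * f^-1))%g.
  by rewrite !mulgA mulgV mul1g.
apply: FA; apply: pointwise_stab_conj; exact: pointwise_stabV.
Qed.

Lemma tau_p_hausdorff : hausdorff_space Hp.
Proof.
move=> f g clfg; apply: homeo_ext => x.
have stabx (h : homeo X) : nbhs (h : Hp) [set k : homeo X | k x = h x].
  apply/tau_p_nbhsP; exists [set x] => [|k kx].
    exact: finite_set1.
  exact: (congr1 h (kx x erefl)).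
by have [h [/= <- <-]] := clfg _ _ (stabx f) (stabx g).
Qed.

End tau_p_theory.

(** * A criterion for indiscreteness *)

Definition finitely_homogeneous (X : topologicalType) :=
  forall (D : set X) x y, finite_set D -> ~ D x -> ~ D y ->
    exists2 k : homeo X, pointwise_stab D k & k x = y.

Definition finitely_displaceable (X : topologicalType) :=
  forall (A : set (homeo X)) (F E : set X),
    nbhs ((1%g : homeo X) : Topological.Pack (tau_k X)) A ->
    finite_set F -> finite_set E ->
    exists2 h : homeo X, A h & forall x, F x -> ~ E (h x).

(** The points of [F] are moved one at a time, each step fixing [D] and the targets
    already reached.  Sources not yet treated need not be fixed, so [F] and its
    image under [g] may overlap. *)
Lemma finitely_homogeneous_set (X : topologicalType) (D F : set X)
    (g : homeo X) : finitely_homogeneous X ->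
  finite_set D -> finite_set F ->
  (forall x, F x -> ~ D x) -> (forall x, F x -> ~ D (g x)) ->
  exists2 k : homeo X, pointwise_stab D k & forall x, F x -> k x = g x.
Proof.
move=> homX fD /finite_seqP[s ->]; elim: s => [|x s IHs] sD sgD.
  by exists 1%g => //; exact: pointwise_stab1.
have [x_s|x_s] := boolP (x \in s).
  have [y ys|y ys|k Dk ks] := IHs.
  - by apply: sD; rewrite /= inE ys orbT.
  - by apply: sgD; rewrite /= inE ys orbT.
  by exists k => // y /=; rewrite inE => /predU1P[->|]; exact: ks.
have [y ys|y ys|k Dk ks] := IHs.
- by apply: sD; rewrite /= inE ys orbT.
- by apply: sgD; rewrite /= inE ys orbT.
have xD : ~ D x by apply: sD; rewrite /= inE eqxx.
have [l Dl lx] : exists2 l : homeo X,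
    pointwise_stab (D `|` g @` [set` s]) l & l (k x) = g x.
  apply: homX.
  - by rewrite finite_setU; split=> //; apply: finite_image; exact: finite_seq.
  - move=> [Dkx|[y ys gyx]].
      by apply: xD; rewrite -(homeoK k x) (pointwise_stabV Dk).
    move: gyx; rewrite -ks// => /homeo_inj yx.
    by move: x_s; rewrite -yx (ys : y \in s).
  - move=> [|[y ys /homeo_inj yx]]; first by apply: sgD; rewrite /= inE eqxx.
    by move: x_s; rewrite -yx (ys : y \in s).
exists (l * k)%g.
  by apply: pointwise_stabM => // y Dy; apply: Dl; left.
move=> y /=; rewrite inE => /predU1P[->//|ys].
by rewrite ks// Dl//; right; exists y.
Qed.

Lemma opens_nbhs (G : choiceType) (t : Topological G) (A : set G) (x : G) :
  opens t A -> A x -> nbhs (x : Topological.Pack t) A.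
Proof. by move=> oA Ax; rewrite (@nbhsE (Topological.Pack t)); exists A. Qed.

Lemma finer_nbhs (G : choiceType) (s t : Topological G) (A : set G) (x : G) :
  opens t `<=` opens s -> nbhs (x : Topological.Pack t) A ->
  nbhs (x : Topological.Pack s) A.
Proof.
move=> ts; rewrite (@nbhsE (Topological.Pack t)) => -[B [oB Bx] BA].
by rewrite (@nbhsE (Topological.Pack s)); exists B => //; split=> //; exact: ts.
Qed.

Section indiscrete.
Context {X : topologicalType}.
Hypotheses (homX : finitely_homogeneous X) (dispX : finitely_displaceable X).

Lemma pointwise_compact_open_indiscrete (t : Topological (homeo X)) :
  is_group_topology t -> opens t `<=` opens (tau_p X) ->
  opens t `<=` opens (tau_k X) -> is_indiscrete t.
Proof.
move=> [mul_t inv_t] tp tk; pose T := Topological.Pack t.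
rewrite /is_indiscrete; apply/seteqP; split=> [A oA|A [->|->]]; last 2 first.
- exact: (@open0 T).
- exact: (@openT T).
have [->|/set0P[a Aa]] := eqVneq A set0; first by left.
right; apply/seteqP; split=> // b _.
(* b is the value of this word at (h, h^-1 k h, k^-1 g), where g = a^-1 b *)
pose w (p : (T * T) * T) : T := (a * (p.1.1 * p.1.2 * p.1.1^-1 * p.2))%g.
have mulT (S : Type) (F : set_system S) (u v : S -> T) (x y : T) : Filter F ->
    u @ F --> x -> v @ F --> y ->
    (fun z => (u z * v z)%g : T) @ F --> ((x * y)%g : T).
  by move=> FF ux vy; apply: cvg_comp (cvg_pair ux vy) (mul_t (x, y)).
pose I : (T * T) * T := ((1%g, 1%g), 1%g).
have cw : w @ nbhs I --> w I.
  have c11 : (fun p : (T * T) * T => p.1.1) @ nbhs I --> (1%g : T).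
    by apply: (@cvg_comp _ _ _ fst fst); exact: cvg_fst.
  have c12 : (fun p : (T * T) * T => p.1.2) @ nbhs I --> (1%g : T).
    by apply: (@cvg_comp _ _ _ fst snd); [exact: cvg_fst|exact: cvg_snd].
  apply: (mulT _ _ (cst a)); first exact: cvg_cst.
  apply: (mulT); last exact: cvg_snd.
  apply: (mulT); first exact: mulT.
  apply: (cvg_comp _ _ c11); exact: inv_t.
have : nbhs (w I) A.
  by rewrite /w /= invg1 !mulg1; exact: opens_nbhs.
move=> /cw[[P S] /= [[[P1 P2] /= [P11 P21] P12P] S1] PSA].
have /tau_p_nbhs1[F2 fF2 F2P2] := finer_nbhs tp P21.
have /tau_p_nbhs1[F3 fF3 F3S] := finer_nbhs tp S1.
have P1k := finer_nbhs tk P11.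
pose g := (a^-1 * b)%g; pose F := F2 `|` F3.
have fF : finite_set F by rewrite finite_setU.
have [h P1h hF] : exists2 h : homeo X, P1 h &
    forall x, F x -> ~ (F `|` g @` F) (h x).
  apply: dispX => //; rewrite finite_setU; split=> //.
  exact: finite_image.
have [x Fx [y Fy hyx]|x Fx [y Fy hyx]|k hFk kF] :=
    @finitely_homogeneous_set X (h @` F) F g homX (finite_image _ fF) fF.
- by apply: (hF y Fy); left; rewrite hyx.
- by apply: (hF y Fy); right; exists x.
have -> : b = w ((h, (h^-1 * k * h)%g), (k^-1 * g)%g).
  by rewrite /w /= /g !mulgA !(mulgK, mulgVK, mulgV, mul1g).
apply: PSA; split=> /=.
  apply: P12P; split=> //=; apply: F2P2.
  by apply: pointwise_stab_conj => _ [x Fx <-]; apply: hFk; exists x => //; left.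
apply: F3S => x Fx; rewrite homeoM -kF ?homeoK//.
by right.
Qed.

Lemma indiscreteP (t : Topological (homeo X)) :
  (is_group_topology t /\ opens t `<=` opens (tau_p X) /\
   opens t `<=` opens (tau_k X)) <-> is_indiscrete t.
Proof.
split=> [[gt [tp tk]]|indt]; first exact: pointwise_compact_open_indiscrete.
pose T := Topological.Pack t.
have nbhsT (x : T) A : nbhs x A -> A = setT.
  rewrite nbhsE => -[B [oB Bx] BA]; apply/seteqP; split=> // y _; apply: BA.
  have : opens t B by [].
  by rewrite indt => -[B0|->//]; move: Bx; rewrite B0.
split; [split|split].
- by move=> p A /nbhsT ->; exact: filterT.
- by move=> p A /nbhsT ->; exact: filterT.
- rewrite indt => A [|] ->.
    exact: (@open0 (Topological.Pack (tau_p X))).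
  exact: (@openT (Topological.Pack (tau_p X))).
- rewrite indt => A [|] ->.
    exact: (@open0 (Topological.Pack (tau_k X))).
  exact: (@openT (Topological.Pack (tau_k X))).
Qed.

Hypotheses (cX : compact [set: X]) (hX : hausdorff_space X).
Hypothesis X0 : [set: X] !=set0.

(** Displaceability of a single point shows that the group is not trivial. *)
Lemma no_minimum_hausdorff_group_topology :
  ~ (exists t : Topological (homeo X), is_minimum_hausdorff_group_topology t).
Proof.
move=> [t [[gt ht] mint]].
have indt : is_indiscrete t.
  apply/indiscreteP; split=> //; split; apply: mint; split.
  - exact: tau_p_group_topology.
  - exact: tau_p_hausdorff.
  - exact: tau_k_group_topology.
  - exact: tau_k_hausdorff.
have [x _] := X0.
have [h _ hx] : exists2 h : homeo X, setT h & forall y, [set x] y -> ~ [set x] (h y).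
  by apply: dispX => //; exact: (@filterT _ (nbhs (_ : Topological.Pack (tau_k X)))).
suff h1 : h = 1%g by apply: (hx x) => //; rewrite h1.
apply: ht => A B.
rewrite !nbhsE => -[U [oU Uh] UA] [V [oV V1] VB].
have : opens t U by [].
rewrite indt => -[U0|UT]; first by move: Uh; rewrite U0.
exists 1%g; split; last exact: VB.
by apply: UA; rewrite UT.
Qed.

End indiscrete.

(** * Homeomorphisms of small support, and transport *)

Section compact_bijection.
Context {X : topologicalType}.
Hypotheses (cX : compact [set: X]) (hX : hausdorff_space X).

Lemma compact_bijection_homeo (f : X -> X) : continuous f -> injective f ->
  (forall y, exists x, f x = y) -> exists h : homeo X, h =1 f.
Proof.
move=> cf injf surjf; pose g y := projT1 (cid (surjf y)).
have gK : cancel g f by move=> y; rewrite /g; case: cid.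
have fK : cancel f g by move=> x; apply: injf; rewrite gK.
have cg : continuous g.
  apply/continuous_closedP => C clC.
  have -> : g @^-1` C = f @` C.
    apply/seteqP; split=> [y Cgy|_ [x Cx <-]] /=; first by exists (g y).
    by rewrite fK.
  apply: compact_closed => //; apply: continuous_compact.
    exact: continuous_subspaceT.
  exact: (subclosed_compact clC cX).
have hf : homeomorphism f by split=> //; exists g.
by exists (Homeo hf).
Qed.

End compact_bijection.

Section local_moves.
Context {X : topologicalType}.

(** The smallness of [k] is expressed by its support, which suffices by
    [supported_homeo_small] below. *)
Definition locally_movable := forall (p : X) (O : set X), open O -> O p ->
  exists W : set X, [/\ open W, W p & forall q, W q ->
    exists2 k : homeo X, pointwise_stab (~` O) k & k p = q].

Lemma supported_homeo_stable (O : set X) (k : homeo X) x :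
  pointwise_stab (~` O) k -> O x -> O (k x).
Proof.
move=> Ok Ox; apply: contrapT => nO.
have /homeo_inj kx := Ok _ nO.
by apply: nO; rewrite kx.
Qed.

Hypotheses (cX : compact [set: X]) (hX : hausdorff_space X).

(** The homeomorphisms supported in small neighborhoods of [z] converge
    continuously to the identity: away from [z] they are eventually the identity,
    and a neighborhood of [z] is mapped into itself by those supported in it. *)
Lemma supported_homeo_small z (A : set (homeo X)) :
  nbhs ((1%g : homeo X) : Topological.Pack (tau_k X)) A ->
  exists O : set X, [/\ open O, O z &
    forall k : homeo X, pointwise_stab (~` O) k -> A k].
Proof.
move=> A1; pose F : set_system (homeo X) :=
  filter_from [set O : set X | open O /\ O z] (fun O => pointwise_stab (~` O)).
have FF : Filter F.
  apply: filter_from_filter; first by exists setT; split=> //; exact: openT.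
  move=> O P [oO Oz] [oP Pz]; exists (O `&` P); first by split=> //; exact: openI.
  by move=> k OPk; split=> x nx; apply: OPk => -[].
suff F1 : F --> ((1%g : homeo X) : Topological.Pack (tau_k X)).
  by have [U [oU Uz] UA] := F1 _ A1; exists U.
apply/(tau_k_cvgP cX hX _ FF) => x B /= Bx.
have [xz|xz] := eqVneq x z.
  have oC : open B° := @open_interior _ B.
  have CB : B° `<=` B := @interior_subset _ B.
  exists (B°, pointwise_stab (~` B°)) => /=.
    split; first exact: nbhs_interior.
    by exists B° => //; split=> //; rewrite -xz.
  by move=> [y k] /= [Cy Ck]; apply: CB; exact: supported_homeo_stable.
move: hX; rewrite open_hausdorff => /(_ _ _ xz)[[U V]] /=.
rewrite !inE => -[Ux Vz] [oU oV UV0].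
exists (B `&` U, pointwise_stab (~` V)) => /=.
  split; last by exists V.
  by apply: filterI => //; exact: (open_nbhs_nbhs (conj oU Ux)).
move=> [y k] /= [[By Uy] Vk]; rewrite Vk// => Vy.
by have : (U `&` V) y by []; rewrite UV0.
Qed.

Hypothesis perfX : forall x : X, ~ open [set x].

Lemma open_not_finite (O E : set X) : open O -> O !=set0 -> finite_set E ->
  exists2 y, O y & ~ E y.
Proof.
move=> oO O0 /finite_seqP[s ->]; elim: s O oO O0 => [|x s IHs] O oO O0.
  by have [y Oy] := O0; exists y.
have [||y [Oy /= yx] ys] := IHs (O `&` ~` [set x]).
- apply: openI => //; apply: closed_openC.
  exact/accessible_closed_set1/hausdorff_accessible.
- apply: contrapT => Ox0; apply: (perfX (x := x)).
  suff <- : O = [set x] by [].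
  have Ox y : O y -> y = x.
    by move=> Oy; apply: contrapT => yx; apply: Ox0; exists y.
  apply/seteqP; split=> [y /Ox//|_ ->].
  by have [y Oy] := O0; rewrite -(Ox y Oy).
- by exists y => //=; rewrite inE => /predU1P[].
Qed.

(** The points of [F] are moved off [E] one at a time, each by a homeomorphism
    close to 1 whose support avoids the points already treated.  Without isolated
    points there is always room outside [E]. *)
Lemma locally_movable_displaceable :
  locally_movable -> finitely_displaceable X.
Proof.
move=> movX A F E A1 /finite_seqP[s ->] fE.
elim: s A A1 => [|x s IHs] A A1.
  by exists 1%g => //; exact: nbhs_singleton A1.
have [mulk _] := tau_k_group_topology cX hX.
have [|[B C] /= [B1 C1] BCA] := mulk (1%g, 1%g) A.
  by rewrite /= mulg1.
have [h Ch hE] := IHs C C1.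
have [[y ys yx]|xs] := pselect (exists2 y, y \in s & y = x).
  exists h.
    rewrite -(mul1g h); apply: (BCA (1%g, h)); split=> //=.
    exact: (@nbhs_singleton (Topological.Pack (tau_k X)) 1%g B B1).
  by move=> z /=; rewrite inE => /predU1P[->|]; [rewrite -yx|]; exact: hE.
have [U [oU Ux UB]] := supported_homeo_small (h x) B1.
pose P := U `&` ~` (h @` [set` s]).
have oP : open P.
  apply: openI => //; apply: closed_openC.
  move/accessible_finite_set_closed : (hausdorff_accessible hX); apply.
  by apply: finite_image; exact: finite_seq.
have Px : P (h x).
  by split=> // -[y ys /homeo_inj yx]; apply: xs; exists y.
have [W [oW Wx movW]] := movX _ _ oP Px.
have [y Wy nEy] := open_not_finite oW (ex_intro _ _ Wx) fE.
have [k Pk kx] := movW y Wy.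
exists (k * h)%g.
  apply: (BCA (k, h)); split=> //; apply: UB => z nUz; apply: Pk.
  by move=> [].
move=> z; rewrite /= inE => /predU1P[->|zs]; first by rewrite /= kx.
rewrite /= Pk; first exact: hE.
by move=> [_]; apply; exists z.
Qed.

End local_moves.
Arguments locally_movable : clear implicits.

Section transport.
Context {X Y : topologicalType} (phi : X -> Y) (psi : Y -> X).
Hypotheses (cphi : continuous phi) (cpsi : continuous psi).
Hypotheses (phiK : cancel phi psi) (psiK : cancel psi phi).

Lemma homeomorphism_conj_subproof (k : homeo Y) :
  homeomorphism (psi \o k \o phi).
Proof.
have cj (l : homeo Y) : continuous (psi \o l \o phi).
  move=> x; apply: (@continuous_comp _ _ _ phi (psi \o l)); first exact: cphi.
  apply: (@continuous_comp _ _ _ l psi); last exact: cpsi.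
  exact: (@homeo_continuous _ l).
split; first exact: cj.
exists (psi \o (k^-1)%g \o phi); split=> [|x|x]; first exact: cj.
  exact: (etrans (congr1 (psi \o (k^-1)%g) (psiK _))
    (etrans (congr1 psi (homeoK k _)) (phiK x))).
exact: (etrans (congr1 (psi \o k) (psiK _))
  (etrans (congr1 psi (homeoVK k _)) (phiK x))).
Qed.

Definition homeo_conj (k : homeo Y) : homeo X :=
  Homeo (homeomorphism_conj_subproof k).

Lemma transport_compact : compact [set: Y] -> compact [set: X].
Proof.
move=> cY; have -> : [set: X] = psi @` [set: Y].
  by apply/seteqP; split=> // x _; exists (phi x).
by apply: continuous_compact => //; exact: continuous_subspaceT.
Qed.

Lemma transport_hausdorff : hausdorff_space Y -> hausdorff_space X.
Proof.
move=> hY x y clxy; apply: (can_inj phiK); apply: hY => A B Ax By.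
have [z [/= Az Bz]] := clxy _ _ (cphi Ax) (cphi By).
by exists (phi z).
Qed.

Lemma transport_homogeneous : finitely_homogeneous Y -> finitely_homogeneous X.
Proof.
move=> homY D x y fD Dx Dy.
have nD z : ~ D z -> ~ (phi @` D) (phi z).
  by move=> nDz [w Dw /(can_inj phiK) wz]; apply: nDz; rewrite -wz.
have [k Dk kx] := homY _ _ _ (finite_image phi fD) (nD _ Dx) (nD _ Dy).
exists (homeo_conj k); last by rewrite /= kx phiK.
by move=> z Dz; rewrite /= Dk ?phiK//; exists z.
Qed.

(** Conjugation by a homeomorphism is continuous for the compact-open topologies. *)
Lemma transport_displaceable : compact [set: Y] -> hausdorff_space Y ->
  finitely_displaceable Y -> finitely_displaceable X.
Proof.
move=> cY hY dispY A F E A1 fF fE.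
have [|h Ah hFE] := dispY (homeo_conj @^-1` A) (phi @` F) (phi @` E) _
  (finite_image _ fF) (finite_image _ fE).
  have FF : Filter (homeo_conj @ nbhs ((1%g : homeo Y) :
    Topological.Pack (tau_k Y))) by exact: fmap_filter.
  suff : homeo_conj @ nbhs ((1%g : homeo Y) : Topological.Pack (tau_k Y)) -->
      ((1%g : homeo X) : Topological.Pack (tau_k X)) by exact.
  apply/(tau_k_cvgP (transport_compact cY) (transport_hausdorff hY) _ FF).
  move=> x B Bx.
  have /cpsi Bx' : nbhs (psi (phi x)) B by rewrite phiK.
  have /(tau_k_cvgP cY hY)/(_ (phi x) _ Bx') [[C D] /= [Cx D1] CD] :
    nbhs ((1%g : homeo Y) : Topological.Pack (tau_k Y)) -->
    ((1%g : homeo Y) : Topological.Pack (tau_k Y)) by exact: cvg_id.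
  exists (phi @^-1` C, homeo_conj @` D) => /=.
    split; first exact: cphi.
    by apply: filterS D1 => k Dk; exists k.
  by move=> [y _] /= [Cy [k Dk <-]]; exact: (CD (phi y, k)).
exists (homeo_conj h) => // x Fx Ex; apply: (hFE (phi x)); first by exists x.
by exists (homeo_conj h x) => //=; rewrite psiK.
Qed.

End transport.

(** Here the size of [h] is not controlled.  For the Hilbert cube, smallness is
    obtained by applying this to the factor of the coordinates of large index. *)
Lemma homogeneous_disjoint (X : topologicalType) (F E : set X) :
  finitely_homogeneous X -> (forall D : set X, finite_set D -> exists y, ~ D y) ->
  finite_set F -> finite_set E ->
  exists h : homeo X, forall x, F x -> ~ E (h x).
Proof.
move=> homX infX /finite_seqP[s ->] fE; elim: s => [|x s [h hE]].
  by exists 1%g.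
have [xs|xs] := pselect ((h @` [set` s]) (h x)).
  exists h => y; rewrite /= inE => /predU1P[->|]; last exact: hE.
  by have [z zs /homeo_inj <-] := xs; exact: hE.
have fs : finite_set (h @` [set` s]) by apply: finite_image; exact: finite_seq.
have [|y /not_orP[ys yE]] := infX (h @` [set` s] `|` E).
  by rewrite finite_setU.
have [k ks kx] := homX _ _ _ fs xs ys.
exists (k * h)%g => z; rewrite /= inE => /predU1P[->|zs]; first by rewrite kx.
by rewrite ks; [exact: hE|exists z].
Qed.

(** * Countable products and the Cantor set *)

Section product_cvg.
Context {I : eqType} {K : I -> topologicalType}.

Lemma cvg_prod_topologyP (F : set_system (prod_topology K)) (f : prod_topology K) :
  Filter F -> F --> f <-> forall i, (fun g : prod_topology K => g i) @ F --> f i.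
Proof.
move=> FF; split=> [Ff i|Ff].
  exact: (cvg_comp _ _ Ff (@proj_continuous I K i f)).
apply/cvg_sup => i A; rewrite nbhsE => -[_ [[B oB <-] Bfi] BA].
by apply: filterS BA _; apply: Ff; exact: open_nbhs_nbhs.
Qed.

Lemma continuous_prod_topologyP (T : topologicalType) (u : T -> prod_topology K) :
  continuous u <-> forall i, continuous (fun t => u t i).
Proof.
split=> [cu i t|cu t].
  by apply: (@continuous_comp _ _ _ u (fun g : prod_topology K => g i));
    [exact: cu|exact: (@proj_continuous I K i)].
apply/cvg_prod_topologyP => i; exact: cu.
Qed.

End product_cvg.

Section cantor.
Implicit Types x y z : cantor_space.

Definition cylinder x n := [set z : cantor_space | forall i, (i < n)%N -> z i = x i].

Lemma cylinder_nbhs x n : nbhs x (cylinder x n).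
Proof.
elim: n => [|n IHn]; first by apply: filterS filterT => z _ i.
have xn : nbhs x [set z : cantor_space | z n = x n].
  have := @proj_continuous nat (fun=> bool) n x [set x n].
  by apply; rewrite nbhs_principalE.
apply: filterS2 IHn xn => z xz zn i.
by rewrite ltnS leq_eqVlt => /predU1P[->//|]; exact: xz.
Qed.

Lemma cylinder_basis x (A : set cantor_space) :
  nbhs x A -> exists n, cylinder x n `<=` A.
Proof.
move=> Ax; pose F : set_system cantor_space := filter_from [set: nat] (cylinder x).
have FF : Filter F.
  apply: filter_from_filter; first by exists 0.
  move=> i j _ _; exists (maxn i j) => // z xz.
  by split=> k ki; apply: xz; rewrite leq_max ki ?orbT.
suff Fx : F --> x by have [n _ nA] := Fx _ Ax; exists n.
apply/(@cvg_prod_topologyP nat (fun=> bool) F x FF) => i B /= Bx.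
exists i.+1 => // z xz /=.
by rewrite xz//; exact: nbhs_singleton.
Qed.

(** The map adds [x + y] modulo 2 to the points of the two cylinders.  This is an
    involution that exchanges the two cylinders, or preserves them when they
    coincide. *)
Lemma cantor_swap x y n : exists2 k : homeo cantor_space, k x = y &
  forall z, ~ cylinder x n z -> ~ cylinder y n z -> k z = z.
Proof.
(* membership in one of the two cylinders, which the map s preserves *)
pose Z z := [forall i : 'I_n, z i == x i] || [forall i : 'I_n, z i == y i].
pose s z : cantor_space := fun i => if Z z then x i (+) y i (+) z i else z i.
have Zs z : Z (s z) = Z z.
  have [Zz|nZ] := boolP (Z z); last first.
    by rewrite -[RHS](negbTE nZ); congr Z; apply/funext => i; rewrite /s (negbTE nZ).
  rewrite /Z /s Zz; move: Zz => /orP[] /forallP zE; apply/orP; [right|left];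
    apply/forallP => i; rewrite (eqP (zE i)).
  - by rewrite addbAC addbb.
  - by rewrite -addbA addbb addbF.
have sK : involutive s.
  move=> z; apply/funext => i; rewrite {1}/s Zs.
  case Zz : (Z z); rewrite /s Zz //.
  by case: (x i) (y i) (z i) => [] [] [].
have cs : continuous s.
  apply/continuous_prod_topologyP => i z A Az.
  apply: filterS (cylinder_nbhs z (maxn n i.+1)) => w zw /=.
  have wi : w i = z i by apply: zw; rewrite leq_max ltnSn orbT.
  have Zw : Z w = Z z.
    have wz (j : 'I_n) : w j = z j by apply: zw; rewrite leq_max ltn_ord.
    by congr (_ || _); apply: eq_forallb => j; rewrite wz.
  by rewrite /s Zw wi; exact: (nbhs_singleton Az).
have hs : homeomorphism s by split=> //; exists s.
exists (Homeo hs) => [|z nx ny] /=; apply/funext => i; rewrite /s.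
  have -> : Z x by apply/orP; left; apply/forallP.
  by rewrite addbAC addbb.
case: ifPn => // /orP[] /forallP zE.
- by case: nx => j jn; exact: (eqP (zE (Ordinal jn))).
- by case: ny => j jn; exact: (eqP (zE (Ordinal jn))).
Qed.

Lemma cantor_homogeneous : finitely_homogeneous cantor_space.
Proof.
move=> D x y fD Dx Dy.
have oD : open (~` D).
  apply: closed_openC.
  by move/accessible_finite_set_closed :
    (hausdorff_accessible cantor_space_hausdorff); apply.
have [m xm] := cylinder_basis (open_nbhs_nbhs (conj oD Dx)).
have [n yn] := cylinder_basis (open_nbhs_nbhs (conj oD Dy)).
have [k kx kD] := cantor_swap x y (maxn m n).
exists k => // z Dz; apply: kD => zE.
- by apply: (xm z) => // i im; apply: zE; rewrite leq_max im.
- by apply: (yn z) => // i im; apply: zE; rewrite leq_max im orbT.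
Qed.

Lemma cantor_displaceable : finitely_displaceable cantor_space.
Proof.
apply: locally_movable_displaceable.
- exact: cantor_space_compact.
- exact: cantor_space_hausdorff.
- exact/perfectTP/cantor_perfect.
move=> p O oO Op.
have [n pn] := cylinder_basis (open_nbhs_nbhs (conj oO Op)).
exists (cylinder p n)°; split; first exact: open_interior.
  exact: cylinder_nbhs.
move=> q /interior_subset pq; have [k kp kO] := cantor_swap p q n.
exists k => // z Oz; apply: kO => zE; apply: Oz; apply: pn => // i ilt.
by rewrite zE// pq.
Qed.

End cantor.

(** * Moving points in a normed space *)

Section continuity.
Context {R : realType} {T : topologicalType}.
Implicit Types f g : T -> R.

Lemma continuous_add f g : continuous f -> continuous g ->
  continuous (fun t => f t + g t).
Proof. by move=> cf cg t; apply: cvgD; [exact: cf|exact: cg]. Qed.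

Lemma continuous_sub f g : continuous f -> continuous g ->
  continuous (fun t => f t - g t).
Proof. by move=> cf cg t; apply: cvgB; [exact: cf|exact: cg]. Qed.

Lemma continuous_mul f g : continuous f -> continuous g ->
  continuous (fun t => f t * g t).
Proof. by move=> cf cg t; apply: cvgM; [exact: cf|exact: cg]. Qed.

Lemma continuous_minr f g : continuous f -> continuous g ->
  continuous (fun t => Num.min (f t) (g t)).
Proof. by move=> cf cg t; apply: continuous_min; [exact: cf|exact: cg]. Qed.

Lemma continuous_maxr f g : continuous f -> continuous g ->
  continuous (fun t => Num.max (f t) (g t)).
Proof. by move=> cf cg t; apply: continuous_max; [exact: cf|exact: cg]. Qed.

End continuity.

Section bump.
Context {R : realType} {V : normedModType R}.
Variables (a w : V) (r : R).
Hypotheses (r0 : 0 < r) (wr : `|w| < r).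

Definition bump (x : V) : R := Num.max 0 (1 - `|x - a| / r).

(** Moves [a] to [a + w] and is the identity outside the ball of radius [r].  As
    [bump] has Lipschitz constant [1 / r], the perturbation [bump x *: w] is a strict
    contraction when [w] is shorter than [r]. *)
Definition bump_move (x : V) : V := x + bump x *: w.

Lemma bump_itv x : 0 <= bump x <= 1.
Proof.
by rewrite /bump le_max lexx ge_max ler01 gerBl divr_ge0// ltW.
Qed.

Lemma bump_move_center : bump_move a = a + w.
Proof.
rewrite /bump_move /bump subrr normr0 mul0r subr0.
by rewrite max_r ?ler01// scale1r.
Qed.

Lemma bump_move_outside x : r <= `|x - a| -> bump_move x = x.
Proof.
move=> rx; rewrite /bump_move /bump max_l ?scale0r ?addr0//.
by rewrite subr_le0 ler_pdivlMr// mul1r.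
Qed.

Lemma bump_lipschitz x y : `|bump x - bump y| <= `|x - y| / r.
Proof.
have maxL (s t : R) : `|Num.max 0 s - Num.max 0 t| <= `|s - t|.
  rewrite ler_norml; case: (ger0P (s - t)) => ?;
    by case: (leP 0 s) => ?; case: (leP 0 t) => ?; lra.
apply: le_trans (maxL _ _) _.
have -> : 1 - `|x - a| / r - (1 - `|y - a| / r) = (`|y - a| - `|x - a|) / r.
  by rewrite mulrBl; ring.
rewrite normrM (gtr0_norm (x := r^-1)) ?invr_gt0// ler_pM2r ?invr_gt0//.
rewrite distrC; apply: le_trans (ler_dist_dist _ _) _.
by rewrite opprB addrA subrK.
Qed.

Lemma dist_continuous : continuous (fun x : V => `|x - a|).
Proof.
move=> x; apply: cvg_norm; apply: cvgB; first exact: cvg_id.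
exact: cvg_cst.
Qed.

Lemma bump_continuous : continuous bump.
Proof.
have cK (y : R) : continuous (fun _ : V => y) by exact: cst_continuous.
exact: (continuous_maxr (cK 0)
  (continuous_sub (cK 1) (continuous_mul dist_continuous (cK r^-1)))).
Qed.

Lemma bump_move_continuous : continuous bump_move.
Proof.
move=> x; apply: cvgD; first exact: cvg_id.
by apply: cvgZr_tmp; exact: bump_continuous.
Qed.

Lemma bump_move_inj : injective bump_move.
Proof.
move=> x y xy; have xyE : x - y = (bump y - bump x) *: w.
  have xE : x = y + bump y *: w - bump x *: w.
    by rewrite -[y + _]xy /bump_move addrK.
  by rewrite {1}xE addrAC [y + _]addrC addrK scalerBl.
have : `|x - y| <= `|x - y| / r * `|w|.
  rewrite {1}xyE normrZ ler_wpM2r// distrC; exact: bump_lipschitz.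
rewrite mulrAC ler_pdivlMr// => H.
apply/eqP; rewrite -subr_eq0 -normr_eq0 eq_le normr_ge0 andbT.
by rewrite leNgt; apply/negP => xy0; move: H; rewrite ler_pM2l// leNgt wr.
Qed.

(** A preimage of [y] lies on the line through [y] in the direction [w], so that the
    intermediate value theorem on this line suffices. *)
Lemma bump_move_surj y : exists x, bump_move x = y.
Proof.
(* a zero s of g satisfies bump_move (y - s *: w) = y *)
pose g (s : R) : R := s - bump (y - s *: w).
have cg : continuous g.
  have cid : continuous (fun s : R => s) by move=> s; exact: cvg_id.
  have cb : continuous (fun s : R => bump (y - s *: w)).
    move=> s; apply: (@continuous_comp _ _ _ (fun s : R => y - s *: w) bump).
      apply: cvgB; first exact: cvg_cst.
      by apply: cvgZr_tmp; exact: cvg_id.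
    exact: bump_continuous.
  exact: (continuous_sub cid cb).
have g0 : g 0 <= 0.
  by rewrite /g sub0r oppr_le0; case/andP: (bump_itv (y - 0 *: w)).
have g1 : 0 <= g 1.
  by rewrite /g subr_ge0; case/andP: (bump_itv (y - 1 *: w)).
have [|s s01 gs] := @IVT R g 0 1 0 ler01 (continuous_subspaceT cg).
  by rewrite ge_min g0 le_max g1 orbT.
exists (y - s *: w); rewrite /bump_move.
by move/eqP: gs; rewrite subr_eq0 => /eqP <-; rewrite subrK.
Qed.

End bump.

Section punctured_ball.
Context {R : realType} {n : nat}.
Local Notation E := 'rV[R]_n.+2.
Implicit Types (a v h : E) (P Q : set E).

(** A segment is connected, hence cannot meet both of two disjoint open sets that
    cover it. *)
Lemma segment_in_open (P Q : set E) v v' : open P -> open Q ->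
  P `&` Q = set0 ->
  (forall t : R, 0 <= t <= 1 -> (P `|` Q) ((1 - t) *: v + t *: v')) ->
  P v -> P v'.
Proof.
move=> oP oQ PQ0 cover Pv; pose g (t : R) : E := (1 - t) *: v + t *: v'.
have cg : continuous g.
  move=> t; apply: cvgD; apply: cvgZr_tmp; last exact: cvg_id.
  by apply: cvgB; [exact: cvg_cst|exact: cvg_id].
have cgo (A : set E) : open A -> open (g @^-1` A).
  by move=> oA; apply: open_comp => // t _; exact: cg.
have : `[0, 1]%classic `&` g @^-1` P = `[0, 1]%classic.
  apply: (segment_connected (a := 0 : R) (b := 1)).
  - exists 0; split; first by rewrite /= in_itv /= lexx ler01.
    by rewrite /= /g subr0 scale1r scale0r addr0.
  - by exists (g @^-1` P) => //; exact: cgo.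
  - exists (~` (g @^-1` Q)); first by apply: open_closedC; exact: cgo.
    apply/seteqP; split=> t [t01] /=.
      move=> Pt; split=> // Qt; have : (P `&` Q) (g t) by [].
      by rewrite PQ0.
    move=> nQt; split=> //; move: t01; rewrite /= in_itv /= => /cover.
    by case.
move=> /seteqP[_ /(_ 1)] [].
  by rewrite /= in_itv /= ler01 lexx.
by rewrite /= /g subrr scale0r add0r scale1r.
Qed.

Definition axis (i : 'I_n.+2) (c : R) : E := c *: delta_mx 0 i.

Lemma axisE i c j : axis i c 0 j = if j == i then c else 0.
Proof. by rewrite /axis !mxE eqxx /=; case: eqP; rewrite ?mulr1 ?mulr0. Qed.

(** The punctured cube is connected: from [h] with [h 0 i != 0], the segment to its
    projection on the axis [i] keeps coordinate [i] constant, and points of two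
    different axes are joined by a segment, which avoids the center.  Dimension at
    least 2 is used to go from one point of an axis to another through a second
    axis. *)
Lemma punctured_box_sub (P Q : set E) a (r : R) : open P -> open Q ->
  P `&` Q = set0 ->
  (forall h, h != 0 -> (forall j, `|h 0 j| < r) -> (P `|` Q) (a + h)) ->
  forall h h', h != 0 -> (forall j, `|h 0 j| < r) ->
    h' != 0 -> (forall j, `|h' 0 j| < r) -> P (a + h) -> P (a + h').
Proof.
move=> oP oQ PQ0 cover h h' h0 hr h'0 h'r.
have seg (u v : E) : (forall j, `|u 0 j| < r) -> (forall j, `|v 0 j| < r) ->
    (forall t : R, 0 <= t <= 1 -> (1 - t) *: u + t *: v != 0) ->
    P (a + u) -> P (a + v).
  move=> ur vr uv0; apply: (segment_in_open oP oQ PQ0) => t t01.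
  have -> : (1 - t) *: (a + u) + t *: (a + v) = a + ((1 - t) *: u + t *: v).
    by rewrite !scalerDr addrACA -scalerDl subrK scale1r.
  apply: cover => [|j]; first exact: uv0.
  pose M := Num.max `|u 0 j| `|v 0 j|.
  apply: (@le_lt_trans _ _ M); last by rewrite gt_max ur vr.
  have -> : M = (1 - t) * M + t * M by ring.
  have /andP[t0 t1] := t01; rewrite !mxE.
  apply: le_trans (ler_normD _ _) _; rewrite !normrM.
  rewrite (ger0_norm t0) (ger0_norm (x := 1 - t)) ?subr_ge0//.
  by apply: lerD; apply: ler_wpM2l; rewrite ?subr_ge0// le_max lexx ?orbT.
have nz (u : E) j : u 0 j != 0 -> u != 0.
  by apply: contraNN => /eqP ->; rewrite mxE.
have coordE (u : E) : u != 0 -> exists i, u 0 i != 0.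
  move=> u0; apply: contrapT => /forallNP ui; move/eqP: u0; apply.
  by apply/rowP => i; rewrite mxE; apply/eqP/negPn/negP; exact: ui.
have axr i c : `|c| < r -> forall j, `|axis i c 0 j| < r.
  move=> cr j; rewrite axisE; case: ifP => // _; rewrite normr0.
  exact: le_lt_trans cr.
have to_axis (u : E) i : u 0 i != 0 -> (forall j, `|u 0 j| < r) ->
    (P (a + u) <-> P (a + axis i (u 0 i))).
  move=> ui ur; split; apply: seg => //; try (by apply: axr);
    move=> t _; apply: (nz _ i);
    by rewrite mxE [X in X + _]mxE [X in _ + X]mxE axisE eqxx -mulrDl subrK mul1r.
have axes i j c c' : i != j -> c != 0 -> c' != 0 -> `|c| < r -> `|c'| < r ->
    P (a + axis i c) -> P (a + axis j c').
  move=> ij c0 c'0 cr c'r; apply: seg; [exact: axr|exact: axr|move=> t _].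
  have [->|t0] := eqVneq t 0.
    by rewrite subr0 scale1r scale0r addr0; apply: (nz _ i); rewrite axisE eqxx.
  apply: (nz _ j); rewrite mxE [X in X + _]mxE [X in _ + X]mxE !axisE eqxx.
  by rewrite [j == i]eq_sym (negbTE ij) mulr0 add0r mulf_neq0.
have [i hi] := coordE _ h0; have [i' h'i'] := coordE _ h'0.
move=> /(to_axis _ _ hi hr) Pi; apply/(to_axis _ _ h'i' h'r); move: Pi.
have [ii'|ii'] := eqVneq i i'; last exact: axes.
have [j ij] : exists j : 'I_n.+2, i != j.
  by have [->|i0] := eqVneq i ord0; [exists ord_max|exists ord0].
move=> /(axes i j _ _ ij hi hi (hr i) (hr i)).
by rewrite -ii' in h'i' *; apply: axes => //; rewrite eq_sym.
Qed.

End punctured_ball.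

(** * Manifolds of dimension at least two *)

(** Turns continuity on a subtype, as in the definition of a manifold, into
    continuity of a total function at the points of an open set. *)
Lemma extension_continuous (X Z : topologicalType) (U : set X) (f : U -> Z)
    (g : X -> Z) : open U -> continuous f -> (forall q : U, g (\val q) = f q) ->
  forall p, U p -> {for p, continuous g}.
Proof.
move=> oU cf gf p Up A; pose p' : U := exist _ p (mem_set Up).
rewrite (gf p' : g p = f p') => /cf.
rewrite /= nbhsE => -[_ [[W oW <-] Wp] WA].
apply: (@filterS _ _ _ (U `&` W)); last first.
  by apply: open_nbhs_nbhs; split; [exact: openI|split].
move=> q [Uq Wq]; pose q' : U := exist _ q (mem_set Uq).
by rewrite /= (gf q' : g q = f q'); exact: (WA q').
Qed.

Section charts.
Context {X Y : topologicalType}.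

(** A homeomorphism between open sets of [X] and [Y] given by total functions, whose
    values outside these sets are arbitrary; this avoids maps between subtypes. *)
Record chart := Chart {
  chart_dom : set X;
  chart_img : set Y;
  chart_fun : X -> Y;
  chart_inv : Y -> X;
  chart_dom_open : open chart_dom;
  chart_img_open : open chart_img;
  chart_funP : forall p, chart_dom p -> chart_img (chart_fun p);
  chart_invP : forall v, chart_img v -> chart_dom (chart_inv v);
  chart_funK : forall p, chart_dom p -> chart_inv (chart_fun p) = p;
  chart_invK : forall v, chart_img v -> chart_fun (chart_inv v) = v;
  chart_fun_continuous : forall p, chart_dom p -> {for p, continuous chart_fun};
  chart_inv_continuous : forall v, chart_img v -> {for v, continuous chart_inv} }.

Lemma homeomorphic_chart (U : set X) (V : set Y) x :
  open U -> U x -> open V -> homeomorphic U V -> exists c : chart, chart_dom c x.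
Proof.
move=> oU Ux oV [f [cf [g [cg fK gK]]]].
pose x' : U := exist _ x (mem_set Ux).
pose u p : Y := if pselect (U p) is left Up then \val (f (exist _ p (mem_set Up)))
  else \val (f x').
pose w v : X := if pselect (V v) is left Vv then \val (g (exist _ v (mem_set Vv)))
  else x.
have uE (q : U) : u (\val q) = \val (f q).
  rewrite /u; case: pselect => [Uq|]; last by case; exact: set_valP.
  by congr (\val (f _)); exact: val_inj.
have wE (q : V) : w (\val q) = \val (g q).
  rewrite /w; case: pselect => [Vq|]; last by case; exact: set_valP.
  by congr (\val (g _)); exact: val_inj.
have cu (p : X) : U p -> {for p, continuous u}.
  apply: (extension_continuous oU _ uE) => q.
  by apply: continuous_comp; [exact: cf|exact: initial_continuous].
have cw (v : Y) : V v -> {for v, continuous w}.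
  apply: (extension_continuous oV _ wE) => q.
  by apply: continuous_comp; [exact: cg|exact: initial_continuous].
have uP p : U p -> V (u p).
  by move=> Up; rewrite (uE (exist _ p (mem_set Up))); exact: set_valP.
have wP v : V v -> U (w v).
  by move=> Vv; rewrite (wE (exist _ v (mem_set Vv))); exact: set_valP.
have uK p : U p -> w (u p) = p.
  by move=> Up; rewrite (uE (exist _ p (mem_set Up))) wE fK.
have wK v : V v -> u (w v) = v.
  by move=> Vv; rewrite (wE (exist _ v (mem_set Vv))) uE gK.
by exists (Chart oU oV uP wP uK wK cu cw).
Qed.

End charts.
Arguments chart : clear implicits.

Section lift.
Context {X Y : topologicalType} (c : chart X Y).
Hypotheses (cX : compact [set: X]) (hX : hausdorff_space X).
Variables (C : set Y) (f : Y -> Y).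
Hypotheses (cC : compact C) (CV : C `<=` chart_img c).
Hypotheses (cf : continuous f) (injf : injective f).
Hypotheses (surjf : forall y, exists x, f x = y).
Hypothesis fC : forall v, ~ C v -> f v = v.

Lemma supported_stable v : chart_img c v -> chart_img c (f v).
Proof.
move=> Vv; apply: contrapT => nV.
have /injf fv : f (f v) = f v by apply: fC => /CV.
by apply: nV; rewrite fv.
Qed.

(** The lift is [f] in the chart and the identity elsewhere.  The two definitions
    agree on the overlap of the open sets [chart_dom c] and the complement of the
    compact, hence closed, set [chart_inv c @` C]. *)
Lemma lift_chart : exists k : homeo X,
  (forall p, chart_dom c p -> k p = chart_inv c (f (chart_fun c p))) /\
  (forall p, ~ (chart_inv c @` C) p -> k p = p).
Proof.
pose k p := if pselect (chart_dom c p) is left _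
  then chart_inv c (f (chart_fun c p)) else p.
have kU p : chart_dom c p -> k p = chart_inv c (f (chart_fun c p)).
  by rewrite /k; case: pselect.
have kN p : ~ chart_dom c p -> k p = p by rewrite /k; case: pselect.
have kC p : ~ (chart_inv c @` C) p -> k p = p.
  move=> nC; have [Up|/kN//] := pselect (chart_dom c p).
  rewrite kU// fC ?chart_funK// => Cp; apply: nC.
  by exists (chart_fun c p) => //; exact: chart_funK.
have kUU p : chart_dom c p -> chart_dom c (k p).
  move=> Up; rewrite kU//; apply: chart_invP; apply: supported_stable.
  exact: chart_funP.
have kinj : injective k.
  move=> p q; have [Up|nUp] := pselect (chart_dom c p);
    have [Uq|nUq] := pselect (chart_dom c q).
  - rewrite !kU// => /(congr1 (chart_fun c)).
    rewrite !chart_invK; try by apply: supported_stable; exact: chart_funP.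
    by move=> /injf /(congr1 (chart_inv c)); rewrite !chart_funK.
  - by rewrite [in RHS]kN// => kpq; case: nUq; rewrite -kpq; exact: kUU.
  - by rewrite [in LHS]kN// => kpq; case: nUp; rewrite kpq; exact: kUU.
  - by rewrite !kN.
have ksurj y : exists p, k p = y.
  have [Uy|nUy] := pselect (chart_dom c y); last by exists y; exact: kN.
  have [v fv] := surjf (chart_fun c y).
  have Vv : chart_img c v.
    apply: contrapT => nV; have fvv : f v = v by apply: fC => /CV.
    by apply: nV; rewrite -fvv fv; exact: chart_funP.
  exists (chart_inv c v); rewrite kU; last exact: chart_invP.
  by rewrite chart_invK// fv chart_funK.
have kcont : continuous k.
  move=> p; have [Up|nUp] := pselect (chart_dom c p).
    have cp : {for p, continuous (chart_inv c \o f \o chart_fun c)}.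
      apply: continuous_comp; first exact: chart_fun_continuous.
      apply: continuous_comp; first exact: cf.
      apply: chart_inv_continuous; apply: supported_stable.
      exact: chart_funP.
    have nU := open_nbhs_nbhs (conj (chart_dom_open c) Up).
    move=> A; rewrite kU// => /cp nA; apply: filterS2 nU nA => q Uq /=.
    by rewrite kU.
  have clC : closed (chart_inv c @` C).
    apply: compact_closed => //; apply: continuous_compact => //.
    apply: continuous_in_subspaceT => v /set_mem /CV.
    exact: chart_inv_continuous.
  have nCp : (~` (chart_inv c @` C)) p.
    by move=> [v /CV/chart_invP Uv vp]; apply: nUp; rewrite -vp.
  have nC := open_nbhs_nbhs (conj (closed_openC clC) nCp).
  by move=> A; rewrite kN// => Ap; apply: filterS2 nC Ap => q nq /=; rewrite kC.
have [h hk] := compact_bijection_homeo cX hX kcont kinj ksurj.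
by exists h; split=> p; rewrite hk; [exact: kU|exact: kC].
Qed.

End lift.

Section manifold.
Context {R : realType} {n : nat} {X : topologicalType}.
Hypothesis mX : compact_manifold R n.+2 X.
Local Notation E := 'rV[R]_n.+2.

Let cX : compact [set: X]. Proof. by case: mX. Qed.
Let hX : hausdorff_space X. Proof. by case: mX => _ _ _ []. Qed.

Lemma manifold_chart x : exists c : chart X E, chart_dom c x.
Proof.
have [_ _ _ _ /(_ x)[U [V [oU Ux oV UV]]]] := mX.
exact: homeomorphic_chart UV.
Qed.

Lemma chart_ball (c : chart X E) x (O : set X) :
  chart_dom c x -> open O -> O x -> exists2 r : R, 0 < r &
    forall v, `|v - chart_fun c x| < r -> chart_img c v /\ O (chart_inv c v).
Proof.
move=> Ux oO Ox; have Vx := chart_funP Ux.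
have : nbhs (chart_fun c x) (chart_img c `&` chart_inv c @^-1` O).
  apply: filterI; first by apply: open_nbhs_nbhs; split=> //; exact: chart_img_open.
  apply: (chart_inv_continuous Vx); rewrite chart_funK//.
  exact: open_nbhs_nbhs.
move=> /nbhs_ballP[r /= r0 rV]; exists r => // v vr; apply: rV.
by rewrite -ball_normE /= distrC.
Qed.

Lemma manifold_locally_movable : locally_movable X.
Proof.
move=> p O oO Op; have [c Up] := manifold_chart p.
have [r r0 rVO] := chart_ball Up oO Op.
pose a := chart_fun c p; pose s := r / 2.
have s0 : 0 < s by rewrite divr_gt0.
have sr : s < r by rewrite /s; lra.
pose W := chart_dom c `&` [set q | `|chart_fun c q - a| < s].
have nW : nbhs p W.
  apply: filterI; first by apply: open_nbhs_nbhs; split=> //; exact: chart_dom_open.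
  have nb : nbhs p (chart_fun c @^-1` ball a s).
    by apply: (chart_fun_continuous Up); exact: nbhsx_ballx.
  apply: filterS nb => q.
  by rewrite /= -ball_normE /= distrC.
exists W°; split; [exact: open_interior|exact: nW|].
move=> q /interior_subset[Uq qs].
pose w : E := chart_fun c q - a; pose C : set E := [set v | `|v - a| <= s].
have cC : compact C.
  apply: bounded_closed_compact.
    exists (s + `|a|); split; first exact: num_real.
    move=> M saM v /= va; apply: le_trans (ltW saM).
    by rewrite -[v](subrK a); apply: le_trans (ler_normD _ _) _; rewrite lerD2r.
  have -> : C = (fun v : E => `|v - a|) @^-1` [set t : R | t <= s] by [].
  apply: closed_comp; last exact: closed_le.
  by move=> v _; exact: dist_continuous.
have CV : C `<=` chart_img c.
  by move=> v /= vs; case: (rVO v (le_lt_trans vs sr)).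
have fC v : ~ C v -> bump_move a w s v = v.
  by move=> /negP; rewrite -ltNge => sv; apply: bump_move_outside => //; exact: ltW.
have cf : continuous (bump_move a w s) by exact: bump_move_continuous.
have injf : injective (bump_move a w s) by exact: bump_move_inj.
have surjf y : exists x, bump_move a w s x = y by exact: bump_move_surj.
have [k [kU kC]] := lift_chart cX hX cC CV cf injf surjf fC.
exists k; last by rewrite kU// -/a bump_move_center /w addrC subrK chart_funK.
move=> z nOz; apply: kC => -[v Cv vz]; apply: nOz; rewrite -vz.
by case: (rVO v (le_lt_trans Cv sr)).
Qed.

Lemma row_norm_lt (h : E) (r : R) : 0 < r ->
  (forall j, `|h 0 j| < r) <-> `|h| < r.
Proof.
move=> r0; have ballP : ball (0 : E) r h <-> forall j, `|h 0 j| < r.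
  split=> [[_ hr] j|hr].
    by have := hr 0 j; rewrite -ball_normE /= mxE sub0r normrN.
  split=> // i j; rewrite -ball_normE /= mxE sub0r normrN.
  by rewrite (ord1 i).
by rewrite -ballP -ball_normE /= sub0r normrN.
Qed.

Lemma half_axis_small (r : R) : 0 < r ->
  axis (n := n) 0 (r / 2) != 0 /\ `|axis (n := n) 0 (r / 2)| < r.
Proof.
move=> r0; split.
  apply/eqP => /rowP/(_ 0); rewrite axisE eqxx mxE => /eqP.
  by rewrite mulf_eq0 invr_eq0 (gt_eqF r0) pnatr_eq0.
apply/row_norm_lt => // j; rewrite axisE; case: ifP => _; last by rewrite normr0.
by rewrite gtr0_norm ?divr_gt0//; lra.
Qed.

Lemma manifold_perfect (x : X) : ~ open [set x].
Proof.
move=> ox; have [c Ux] := manifold_chart x.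
have [r r0 rV] := chart_ball Ux ox erefl.
have [h0 hr] := half_axis_small r0.
have [|Vh hx] := rV (chart_fun c x + axis 0 (r / 2)); first by rewrite addrC addKr.
have := chart_invK Vh; rewrite hx => /eqP.
by rewrite -subr_eq0 opprD addrA subrr sub0r oppr_eq0 (negbTE h0).
Qed.

Lemma chart_preimage_open (c : chart X E) (P : set X) :
  open P -> open (chart_img c `&` chart_inv c @^-1` P).
Proof.
move=> oP; rewrite openE => v [Vv Pv]; apply: filterI.
  by apply: open_nbhs_nbhs; split=> //; exact: chart_img_open.
by apply: (chart_inv_continuous Vv); exact: open_nbhs_nbhs.
Qed.

Lemma manifold_punctured_nbhs (d : X) (O P Q : set X) :
  open O -> O d -> open P -> open Q -> P `&` Q = set0 ->
  (forall z, O z -> z <> d -> P z \/ Q z) ->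
  exists2 B, nbhs d B & (forall z, B z -> z <> d -> P z) \/
                        (forall z, B z -> z <> d -> Q z).
Proof.
move=> oO Od oP oQ PQ0 OPQ; have [c Ud] := manifold_chart d.
have [r r0 rVO] := chart_ball Ud oO Od.
pose a := chart_fun c d; pose PE S := chart_img c `&` chart_inv c @^-1` S.
have oPE S : open S -> open (PE S) by exact: chart_preimage_open.
have nB : nbhs d (chart_dom c `&` chart_fun c @^-1` ball a r).
  apply: filterI; first by apply: open_nbhs_nbhs; split=> //; exact: chart_dom_open.
  by apply: (chart_fun_continuous Ud); exact: nbhsx_ballx.
have PEQ0 : PE P `&` PE Q = set0.
  apply/seteqP; split=> // v [[_ Pv] [_ Qv]].
  by have : (P `&` Q) (chart_inv c v) by []; rewrite PQ0.
have cover (h : E) : h != 0 -> (forall j, `|h 0 j| < r) -> (PE P `|` PE Q) (a + h).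
  move=> h0 /row_norm_lt -/(_ r0) hr.
  have [|Vh Oh] := rVO (a + h); first by rewrite addrC addKr.
  have hd : chart_inv c (a + h) <> d.
    move=> hd; move/eqP: h0; apply.
    by apply: (addrI a); rewrite addr0 -(chart_invK Vh) hd.
  by have [Pz|Qz] := OPQ _ Oh hd; [left|right].
have coverC (h : E) : h != 0 -> (forall j, `|h 0 j| < r) -> (PE Q `|` PE P) (a + h).
  by move=> h0 hr; rewrite setUC; exact: cover.
have [h0 /row_norm_lt -/(_ r0) hr] := half_axis_small r0.
have Bh z : (chart_dom c `&` chart_fun c @^-1` ball a r) z -> z <> d ->
    exists h : E, [/\ h != 0, forall j, `|h 0 j| < r & chart_fun c z = a + h].
  move=> [Uz /= az] zd; exists (chart_fun c z - a); split.
  - apply/eqP => /eqP; rewrite subr_eq0 => /eqP /(congr1 (chart_inv c)).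
    by rewrite /a !chart_funK.
  - by apply/row_norm_lt => //; move: az; rewrite -ball_normE /= distrC.
  - by rewrite addrC subrK.
have PEz (S : set X) z : chart_dom c z -> PE S (chart_fun c z) -> S z.
  by move=> Uz [_]; rewrite /= chart_funK.
exists (chart_dom c `&` chart_fun c @^-1` ball a r) => //.
have [Ph|Qh] := cover _ h0 hr; [left|right] => z Bz zd; apply: PEz (Bz.1) _;
  have [h [hn0 hnr ->]] := Bh z Bz zd.
- apply: (punctured_box_sub (oPE P oP) (oPE Q oQ)
    PEQ0 cover h0 hr hn0 hnr Ph).
- rewrite setIC in PEQ0.
  apply: (punctured_box_sub (oPE Q oQ) (oPE P oP)
    PEQ0 coverC h0 hr hn0 hnr Qh).
Qed.

End manifold.

(** Adding to [P] and to [Q] the points of [D] that have a punctured neighborhood in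
    them gives two open sets that cover [X].  They remain disjoint because a
    neighborhood never consists of a single point. *)
Lemma connected_complement (X : topologicalType) (D P Q : set X) :
  connected [set: X] -> (forall x : X, ~ open [set x]) ->
  open P -> open Q -> P `&` Q = set0 -> P `|` Q = ~` D ->
  (forall d, D d -> exists2 B, nbhs d B &
    (forall z, B z -> z <> d -> P z) \/ (forall z, B z -> z <> d -> Q z)) ->
  P !=set0 -> Q = set0.
Proof.
move=> conX perfX oP oQ PQ0 PQD locD [x Px].
pose fill (S : set X) := S `|` [set d | D d /\
  exists2 B, nbhs d B & forall z, B z -> z <> d -> S z].
have open_fill S : open S -> open (fill S).
  move=> oS; rewrite openE => z [Sz|[Dz [B Bz BS]]].
    by apply: (@filterS _ _ _ S) => [y|]; [left|exact: open_nbhs_nbhs].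
  apply: filterS (Bz) => y By; have [->|yz] := pselect (y = z).
    by right; split=> //; exists B => //.
  by left; exact: BS.
have PQN z : P z -> Q z -> False.
  by move=> Pz Qz; have : (P `&` Q) z by []; rewrite PQ0.
have PQnD z : P z \/ Q z -> ~ D z by move=> ?; rewrite -[~ D z]/((~` D) z) -PQD.
have disj z : fill P z -> fill Q z -> False.
  move=> [Pz [|[/PQnD]]|[Dz [B Bz BP]]]; [exact: PQN|by case; left|].
  move=> [Qz|[_ [B' B'z BQ]]]; first by case: (PQnD z) => //; right.
  apply: (perfX z); suff <- : (B `&` B')° = [set z] by exact: open_interior.
  apply/seteqP; split=> [y /interior_subset[By B'y]|_ ->]; last exact: filterI.
  by apply: contrapT => yz; apply: (PQN y); [exact: BP|exact: BQ].
have cover z : fill P z \/ fill Q z.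
  have [Dz|nDz] := pselect (D z).
    by have [B Bz [BP|BQ]] := locD z Dz; [left|right]; right; split=> //; exists B.
  have [Pz|Qz] : (P `|` Q) z by rewrite PQD.
    by left; left.
  by right; left.
have fillT : fill P = setT.
  apply: conX; first by exists x; left.
    by exists (fill P); rewrite ?setTI//; exact: open_fill.
  exists (~` fill Q); first by apply: open_closedC; exact: open_fill.
  rewrite setTI; apply/seteqP; split=> z; first by move=> Pz /(disj z Pz).
  by case: (cover z).
apply/seteqP; split=> // z Qz; apply: (disj z); last by left.
by rewrite fillT.
Qed.

Section manifold_homogeneous.
Context {R : realType} {n : nat} {X : topologicalType}.
Hypothesis mX : compact_manifold R n.+2 X.

(** The set [P] is the orbit of [x] under the stabilizer of [D], and [Q] is the union
    of the other orbits outside [D]. *)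
Lemma manifold_homogeneous : finitely_homogeneous X.
Proof.
move=> D x y fD Dx Dy.
have [_ conX cX [hX _] _] := mX.
have clD (S : set X) : finite_set S -> closed S.
  by move/accessible_finite_set_closed : (hausdorff_accessible hX); apply.
have oD : open (~` D) by apply: closed_openC; exact: clD.
pose P := [set z | exists2 k : homeo X, pointwise_stab D k & k x = z].
have move_near z : ~ D z -> exists2 W, nbhs z W & forall q, W q ->
    exists2 k : homeo X, pointwise_stab D k & k z = q.
  move=> Dz; have [W [oW Wz WD]] := manifold_locally_movable mX oD Dz.
  exists W; first exact: open_nbhs_nbhs.
  by move=> q /WD[k kD kz]; exists k => // d Dd; apply: kD => /(_ Dd).
have PD z : P z -> ~ D z.
  move=> [k Dk <-] Dkx; apply: Dx.
  by rewrite -(homeoK k x) (pointwise_stabV Dk).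
pose Q := ~` D `&` ~` P.
have oP : open P.
  rewrite openE => z Pz; have [W Wz WD] := move_near z (PD z Pz).
  apply: filterS Wz => q /WD[l Dl lz]; have [k Dk kx] := Pz.
  by exists (l * k)%g; [exact: pointwise_stabM|rewrite homeoM kx].
have oQ : open Q.
  rewrite openE => z [Dz Pz]; have [W Wz WD] := move_near z Dz.
  apply: filterS Wz => q /WD[l Dl lz]; split.
    by rewrite -lz => Dlz; apply: Dz; rewrite -(homeoK l z) (pointwise_stabV Dl).
  move=> [k Dk kx]; apply: Pz; exists (l^-1 * k)%g.
    by apply: pointwise_stabM => //; exact: pointwise_stabV.
  by rewrite homeoM kx -lz homeoK.
have PQ0 : P `&` Q = set0 by apply/seteqP; split=> // z [Pz []].
have PQD : P `|` Q = ~` D.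
  apply/seteqP; split=> z; first by move=> [/PD|[]].
  by move=> Dz; have [|] := pselect (P z); [left|right].
have Q0 : Q = set0.
  apply: (connected_complement conX (manifold_perfect mX) oP oQ PQ0 PQD); last first.
    by exists x; exists 1%g.
  move=> d Dd; apply: (manifold_punctured_nbhs mX (O := ~` (D `\ d))) => //.
  - by apply: closed_openC; apply: clD; exact: finite_setD.
  - by move=> [_]; apply.
  - move=> z nDz zd; have : (~` D) z by move=> Dz; apply: nDz.
    by rewrite -PQD.
apply: contrapT => nP; suff : Q y by rewrite Q0.
by split.
Qed.

Lemma manifold_displaceable : finitely_displaceable X.
Proof.
have [_ _ cX [hX _] _] := mX.
apply: locally_movable_displaceable => //; first exact: (manifold_perfect mX).
exact: (manifold_locally_movable mX).
Qed.

End manifold_homogeneous.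

(** * Homeomorphisms of the unit interval and of the unit square *)

Lemma itv_avoid_finite (R : realFieldType) (a b : R) (E : set R) :
  a < b -> finite_set E -> exists t, a < t < b /\ ~ E t.
Proof.
move=> ab /finite_seqP[s ->]; elim: s a b ab => [|x s IHs] a b ab.
  by exists ((a + b) / 2); split=> //; lra.
have [xm|xm] := leP x ((a + b) / 2).
  have [|t [tab ts]] := IHs ((a + b) / 2) b; first by lra.
  exists t; split; first lra.
  by rewrite /= inE => /predU1P[|/ts//]; lra.
have [|t [tab ts]] := IHs a ((a + b) / 2); first by lra.
exists t; split; first lra.
by rewrite /= inE => /predU1P[|/ts//]; lra.
Qed.

Section odds.
Context {R : realType}.
Implicit Types u t a b : R.

(** Multiplies the odds [t / (1 - t)] by [expR u].  This one-parameter group of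
    homeomorphisms of the unit interval is transitive on its interior. *)
Definition scale_odds u t := expR u * t / (expR u * t + (1 - t)).

Lemma scale_odds_denom_gt0 u t : 0 <= t <= 1 -> 0 < expR u * t + (1 - t).
Proof.
move=> /andP[t0 t1]; have u0 := expR_gt0 u.
have [->|t_lt1] := eqVneq t 1; first by rewrite mulr1 subrr addr0.
have ut : 0 <= expR u * t by rewrite mulr_ge0// ltW.
suff : t < 1 by lra.
by rewrite lt_neqAle t_lt1.
Qed.

Lemma scale_odds_itv u t : 0 <= t <= 1 -> 0 <= scale_odds u t <= 1.
Proof.
move=> t01; have d0 := scale_odds_denom_gt0 u t01.
have u0 := expR_gt0 u; have /andP[t0 t1] := t01.
rewrite /scale_odds divr_ge0 ?mulr_ge0 ?(ltW u0) ?(ltW d0)//=.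
by rewrite ler_pdivrMr// mul1r lerDl subr_ge0.
Qed.

Lemma scale_odds0 t : scale_odds 0 t = t.
Proof. by rewrite /scale_odds expR0 mul1r addrCA subrr addr0 divr1. Qed.

Lemma scale_oddsK u t : 0 <= t <= 1 -> scale_odds (- u) (scale_odds u t) = t.
Proof.
move=> t01; have d0 := scale_odds_denom_gt0 u t01.
have u0 := expR_gt0 u; rewrite /scale_odds expRN.
move: (expR u) u0 d0 => e e0 d0.
field; rewrite !gt_eqF//=; lra.
Qed.

Definition logit t := ln (t / (1 - t)).

Lemma scale_odds_logit a b : 0 < a < 1 -> 0 < b < 1 ->
  scale_odds (logit b - logit a) a = b.
Proof.
move=> a01 b01; rewrite /scale_odds /logit expRB !lnK ?posrE ?divr_gt0; try lra.
by field; apply/and3P; split; apply/negP => /eqP; nra.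
Qed.

Lemma cvg_scale_odds (T : Type) (F : set_system T) (FF : Filter F)
    (u t : T -> R) u0 t0 : 0 <= t0 <= 1 ->
  u @ F --> u0 -> t @ F --> t0 ->
  (fun x => scale_odds (u x) (t x)) @ F --> scale_odds u0 t0.
Proof.
move=> t01 uu0 tt0.
have eu : (fun x => expR (u x) * t x) @ F --> expR u0 * t0.
  by apply: cvgM tt0; apply: (cvg_comp _ _ uu0); exact: continuous_expR.
apply: (cvgM eu); apply: cvgV; first by rewrite gt_eqF// scale_odds_denom_gt0.
by apply: cvgD => //; apply: cvgB => //; exact: cvg_cst.
Qed.

End odds.

Section turn.
Context {R : realType}.
Implicit Types a b c p q : R.

(** With [turn2], a homeomorphism of the unit square that turns the boundary near
    the left side.  The part of the left side with [b <= 2 / 3] goes to the part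
    [p <= 1 / 4] of the bottom side, the other part of the left side is stretched
    over the whole left side, and the half [a >= 1 / 2] is fixed.  The vertical
    segment at [a <= 1 / 2] goes to a Z-shaped path, which follows the vertical line
    at [a] down to the height [2 a], then a horizontal segment, then the vertical
    line at [a / 2 + 1 / 4] down to the bottom side. *)
Definition turn1 a b :=
  let a0 := Num.min a 2^-1 in let c := b * (3 - 4 * a0) in
  Num.max a0 (Num.min (a0 / 2 + 4^-1) ((6 * a0 + 2 - c) / 8)) + (a - a0).

Definition turn2 a b :=
  let a0 := Num.min a 2^-1 in let c := b * (3 - 4 * a0) in
  Num.max (c - 2 + 4 * a0) (Num.min (2 * a0) c).

(** With [unturn2], the inverse of the pair [turn1], [turn2]. *)
Definition unturn1 p q :=
  let p0 := Num.min p 2^-1 in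
  Num.min p0 (Num.max (2 * p0 - 2^-1) (q / 2)) + (p - p0).

Definition unturn2 p q :=
  let p0 := Num.min p 2^-1 in
  let a0 := Num.min p0 (Num.max (2 * p0 - 2^-1) (q / 2)) in
  (q - 8 * p0 + 4 * a0 + 2) / (3 - 4 * a0).

Ltac minmax := repeat
  match goal with
  | |- context [Order.min ?a ?b] =>
      (rewrite (@min_l _ _ a b); [|lra]) || (rewrite (@min_r _ _ a b); [|lra])
  | |- context [Order.max ?a ?b] =>
      (rewrite (@max_l _ _ a b); [|lra]) || (rewrite (@max_r _ _ a b); [|lra])
  end.

(** The regimes are the half of the square that is fixed and the three parts of the
    Z-shaped path: its upper vertical part, its horizontal part and its lower
    vertical part. *)
Inductive turn_spec a b : R -> R -> Prop :=
| TurnFixed of 2^-1 <= a : turn_spec a b a b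
| TurnDown c of a <= 2^-1 & c = b * (3 - 4 * a) & 2 - 2 * a <= c :
    turn_spec a b a (c - 2 + 4 * a)
| TurnAcross c of a <= 2^-1 & c = b * (3 - 4 * a) & 2 * a <= c & c <= 2 - 2 * a :
    turn_spec a b ((6 * a + 2 - c) / 8) (2 * a)
| TurnUp c of a <= 2^-1 & c = b * (3 - 4 * a) & c <= 2 * a :
    turn_spec a b (a / 2 + 4^-1) c.

Lemma turnP a b : 0 <= a <= 1 -> 0 <= b <= 1 ->
  turn_spec a b (turn1 a b) (turn2 a b).
Proof.
move=> a01 b01; rewrite /turn1 /turn2 /=.
have [a2|a2] := leP a 2^-1; last first.
  have -> : b * (3 - 4 * 2^-1) = b by field.
  minmax.
  have -> : 2^-1 + (a - 2^-1) = a by ring.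
  have -> : b - 2 + 4 * 2^-1 = b by field.
  by apply: TurnFixed; exact: ltW.
rewrite subrr addr0.
have [c3|c3] := leP (2 - 2 * a) (b * (3 - 4 * a)).
  by minmax; exact: TurnDown.
have [c2|c2] := leP (2 * a) (b * (3 - 4 * a)).
  by minmax; apply: TurnAcross => //; exact: ltW.
by minmax; apply: TurnUp => //; exact: ltW.
Qed.

Inductive unturn_spec p q : R -> R -> Prop :=
| UnturnFixed of 2^-1 <= p : unturn_spec p q p q
| UnturnDown b of p <= 2^-1 & b * (3 - 4 * p) = q - 4 * p + 2 & 2 * p <= q :
    unturn_spec p q p b
| UnturnAcross b of p <= 2^-1 & b * (3 - 4 * (q / 2)) = 3 * q - 8 * p + 2 &
    4 * p - 1 <= q & q <= 2 * p : unturn_spec p q (q / 2) b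
| UnturnUp b of p <= 2^-1 & b * (3 - 4 * (2 * p - 2^-1)) = q & q <= 4 * p - 1 :
    unturn_spec p q (2 * p - 2^-1) b.

Lemma unturnP p q : 0 <= p <= 1 -> 0 <= q <= 1 ->
  unturn_spec p q (unturn1 p q) (unturn2 p q).
Proof.
move=> p01 q01; rewrite /unturn1 /unturn2 /=.
have [p2|p2] := leP p 2^-1; last first.
  minmax.
  have -> : 2^-1 + (p - 2^-1) = p by ring.
  have -> : (q - 8 / 2 + 4 / 2 + 2) / (3 - 4 / 2) = q.
    have -> : 3 - 4 / 2 = 1 :> R by lra.
    by rewrite divr1; lra.
  by apply: UnturnFixed; exact: ltW.
rewrite subrr addr0.
have [q3|q3] := leP (2 * p) q.
  by minmax; apply: UnturnDown => //; rewrite divfK ?gt_eqF//; lra.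
have [q2|q2] := leP (4 * p - 1) q.
  minmax; apply: UnturnAcross => //; last exact: ltW.
  by rewrite divfK ?gt_eqF//; lra.
by minmax; apply: UnturnUp => //; [rewrite divfK ?gt_eqF//; lra|exact: ltW].
Qed.

Lemma turn_itv a b : 0 <= a <= 1 -> 0 <= b <= 1 ->
  0 <= turn1 a b <= 1 /\ 0 <= turn2 a b <= 1.
Proof.
move=> a01 b01; have c0 a' : a' <= 2^-1 -> 0 <= b * (3 - 4 * a') <= 3 - 4 * a'.
  by move=> a2; rewrite mulr_ge0 ?ler_piMl//; lra.
by case: turnP => // [c /c0 + ->|c /c0 + ->|c /c0 + ->] *; split; lra.
Qed.

Lemma turn_oitv a b : 0 < a < 1 -> 0 < b < 1 ->
  0 < turn1 a b < 1 /\ 0 < turn2 a b < 1.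
Proof.
move=> a01 b01; have c0 a' : a' <= 2^-1 -> 0 < b * (3 - 4 * a') < 3 - 4 * a'.
  by move=> a2; rewrite mulr_gt0 ?gtr_pMl//; lra.
by case: turnP; try lra; move=> // c /c0 + ->; split; lra.
Qed.

(** Below the height 1/2 and off the right side, the first coordinate becomes
    interior even for points of the boundary, and the second one is again admissible
    as first coordinate in the next square. *)
Lemma turn_away a b : 0 <= a < 1 -> 0 <= b -> b <= 2^-1 ->
  0 < turn1 a b < 1 /\ 0 <= turn2 a b < 1.
Proof.
move=> a01 b0 b1.
have c0 a' : a' <= 2^-1 -> 0 <= b * (3 - 4 * a') <= (3 - 4 * a') / 2.
  by move=> a2; rewrite mulr_ge0 ?[_ / 2]mulrC ?ler_wpM2r//; lra.
by case: turnP; try lra; move=> // c /c0 + ->; split; lra.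
Qed.

(** The factor 1/2 is what makes the infinite composition of turns injective. *)
Lemma unturn1_contract p q q' :
  `|unturn1 p q - unturn1 p q'| <= `|q - q'| / 2.
Proof.
rewrite /unturn1 /=; move: (Num.min p _) => p0; move: (2 * p0 - _) => m.
wlog qq : q q' / q <= q'.
  move=> W; have [/W//|/ltW qq] := leP q q'.
  by rewrite distrC [`|q - q'|]distrC; exact: W.
rewrite [`|q - q'|]ler0_norm ?subr_le0// ler_norml.
case: (leP m (q / 2)) => ?; case: (leP m (q' / 2)) => ?; repeat
  match goal with |- context [Order.min p0 ?x] => case: (leP p0 x) => ? end; lra.
Qed.

Lemma unturn_itv p q : 0 <= p <= 1 -> 0 <= q <= 1 ->
  0 <= unturn1 p q <= 1 /\ 0 <= unturn2 p q <= 1.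
Proof.
move=> p01 q01.
have bP b d : 0 < d -> 0 <= b * d <= d -> 0 <= b <= 1.
  by move=> d0; rewrite pmulr_lge0// ger_pMl.
case: unturnP => // b p2 bE *; split; try lra.
- by apply: (bP b (3 - 4 * p)); rewrite ?bE; lra.
- by apply: (bP b (3 - 4 * (q / 2))); rewrite ?bE; lra.
- by apply: (bP b (3 - 4 * (2 * p - 2^-1))); rewrite ?bE; lra.
Qed.

Lemma cancel_denominator a a' b b' : a <= 2^-1 -> a' = a ->
  b' * (3 - 4 * a') = b * (3 - 4 * a) -> a' = a /\ b' = b.
Proof.
move=> a2 -> bb; split=> //; apply: mulIf bb.
by rewrite gt_eqF//; lra.
Qed.

Lemma turnK a b : 0 <= a <= 1 -> 0 <= b <= 1 ->
  unturn1 (turn1 a b) (turn2 a b) = a /\ unturn2 (turn1 a b) (turn2 a b) = b.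
Proof.
move=> a01 b01; have [p01 q01] := turn_itv a01 b01.
move: p01 q01; case: (turnP a01 b01) => [a2|c a2 cE c1|c a2 cE c1 c2|c a2 cE c1] p01 q01;
  case: (unturnP p01 q01) => [p2|b' p2 b'E q1|b' p2 b'E q1 q2|b' p2 b'E q1];
  try (by []);
  try (have aE : a = 2^-1 by lra);
  try (subst a; split; lra);
  try ((have bE : b = 1 by lra); subst a b; split; lra);
  by apply: cancel_denominator => //; rewrite ?b'E -?cE; lra.
Qed.

Lemma unturnK p q : 0 <= p <= 1 -> 0 <= q <= 1 ->
  turn1 (unturn1 p q) (unturn2 p q) = p /\ turn2 (unturn1 p q) (unturn2 p q) = q.
Proof.
move=> p01 q01; have [a01 b01] := unturn_itv p01 q01.
move: a01 b01.
case: (unturnP p01 q01) => [p2|b p2 bE q1|b p2 bE q1 q2|b p2 bE q1] a01 b01;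
  case: (turnP a01 b01) => [a2|c a2 cE c1|c a2 cE c1 c2|c a2 cE c1];
  try ((have pE : p = 2^-1 by lra); subst p);
  try ((have qE : q = 1 by lra); subst q);
  try (rewrite -> bE in cE);
  by split; lra.
Qed.

End turn.

Section continuous_turn.
Context {R : realType} {T : topologicalType}.
Implicit Types f g : T -> R.

Lemma continuous_turn f g : continuous f -> continuous g ->
  continuous (fun t => turn1 (f t) (g t)) /\
  continuous (fun t => turn2 (f t) (g t)).
Proof.
move=> cf cg.
have cK (x : R) : continuous (fun _ : T => x) by exact: cst_continuous.
have ca0 := continuous_minr cf (cK 2^-1).
have cc := continuous_mul cg (continuous_sub (cK 3) (continuous_mul (cK 4) ca0)).
split.
  exact: (continuous_add (continuous_maxr ca0 (continuous_minr
    (continuous_add (continuous_mul ca0 (cK 2^-1)) (cK 4^-1))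
    (continuous_mul (continuous_sub (continuous_add (continuous_mul (cK 6) ca0)
      (cK 2)) cc) (cK 8^-1)))) (continuous_sub cf ca0)).
exact: (continuous_maxr
  (continuous_add (continuous_sub cc (cK 2)) (continuous_mul (cK 4) ca0))
  (continuous_minr (continuous_mul (cK 2) ca0) cc)).
Qed.

End continuous_turn.

(** * The Hilbert cube *)

Section unit_interval.
Context {R : realType}.

Definition unit_itv : topologicalType := set_type [set` `[0, 1]%R : interval R].

Implicit Types i : unit_itv.

Definition to_real i : R := \val i.

Lemma to_real_itv i : 0 <= to_real i <= 1.
Proof. by have := set_valP i; rewrite /= in_itv. Qed.

Lemma to_real_inj : injective to_real.
Proof. exact: val_inj. Qed.

Lemma to_real_continuous : continuous to_real.
Proof. exact: initial_continuous. Qed.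

Lemma to_unit_subproof (x : R) :
  Num.max 0 (Num.min x 1) \in ([set` `[0, 1]%R : interval R] : set R).
Proof.
apply/mem_set; rewrite /= in_itv /= le_max lexx ge_max ler01 ge_min lexx.
by rewrite orbT.
Qed.

Definition to_unit (x : R) : unit_itv :=
  exist (fun y => y \in ([set` `[0, 1]%R : interval R] : set R)) _
    (to_unit_subproof x).

Lemma to_unitK (x : R) : 0 <= x <= 1 -> to_real (to_unit x) = x.
Proof. by move=> /andP[x0 x1]; rewrite /to_real /= min_l// max_r. Qed.

Lemma to_realK : cancel to_real to_unit.
Proof. by move=> i; apply: to_real_inj; rewrite to_unitK// to_real_itv. Qed.

Lemma cvg_unit_itv (F : set_system unit_itv) i : Filter F ->
  to_real @ F --> to_real i -> F --> i.
Proof.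
move=> FF Fi A; rewrite nbhsE => -[_ [[B oB <-] Bi] BA].
by apply: filterS BA _; apply: Fi; exact: open_nbhs_nbhs.
Qed.

Lemma to_unit_continuous : continuous to_unit.
Proof.
move=> x; apply: cvg_unit_itv.
have cK (y : R) : continuous (fun _ : R => y) by exact: cst_continuous.
have cid : continuous (fun y : R => y) by move=> y; exact: cvg_id.
exact: (continuous_maxr (cK 0) (continuous_minr cid (cK 1))).
Qed.

Lemma unit_itv_hausdorff : hausdorff_space unit_itv.
Proof.
move=> i j clij; apply: to_real_inj; apply: (@Rhausdorff R) => A B Ai Bj.
have [k [/= Ak Bk]] := clij _ _ (to_real_continuous Ai) (to_real_continuous Bj).
by exists (to_real k).
Qed.

Lemma unit_itv_compact : compact [set: unit_itv].
Proof.
have -> : [set: unit_itv] = to_unit @` `[0, 1]%classic.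
  apply/seteqP; split=> // i _; exists (to_real i); last exact: to_realK.
  by rewrite /= in_itv /= to_real_itv.
apply: continuous_compact; last exact: segment_compact.
by apply: continuous_subspaceT => x; exact: to_unit_continuous.
Qed.

End unit_interval.

Section hilbert_cube.
Context {R : realType}.
Local Notation Q := (hilbert_cube R).
Implicit Types (x y z : Q) (n m : nat).

Definition coord n z : R := to_real (z n).

Lemma coord_itv n z : 0 <= coord n z <= 1.
Proof. exact: to_real_itv. Qed.

Lemma coord_ext z z' : (forall n, coord n z = coord n z') -> z = z'.
Proof. by move=> zz; apply/funext => n; apply: to_real_inj; exact: zz. Qed.

Lemma coord_continuous n : continuous (coord n).
Proof.
move=> z; apply: (@continuous_comp Q _ _ (fun z : Q => z n) to_real).
  exact: (@proj_continuous nat (fun=> @unit_itv R) n z).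
exact: to_real_continuous.
Qed.

Definition of_coords (f : nat -> R) : Q := fun n => to_unit (f n).

Lemma coord_of_coords (f : nat -> R) n :
  0 <= f n <= 1 -> coord n (of_coords f) = f n.
Proof. exact: to_unitK. Qed.

Lemma cvg_hilbert_cube (F : set_system Q) z : Filter F ->
  (forall n, coord n @ F --> coord n z) -> F --> z.
Proof.
move=> FF Fz; apply/(@cvg_prod_topologyP nat (fun=> @unit_itv R)) => n.
by apply: cvg_unit_itv; exact: Fz.
Qed.

Lemma continuous_hilbert_cube (T : topologicalType) (u : T -> Q) :
  (forall n, continuous (fun t => coord n (u t))) -> continuous u.
Proof. by move=> cu t; apply: cvg_hilbert_cube => n; exact: cu. Qed.

Lemma hilbert_cube_compact : compact [set: Q].
Proof.
have := @tychonoff nat (fun=> @unit_itv R) (fun=> setT) (fun=> unit_itv_compact).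
by congr (compact _); apply/seteqP.
Qed.

Lemma hilbert_cube_hausdorff : hausdorff_space Q.
Proof.
exact: (@hausdorff_product nat (fun=> @unit_itv R) (fun=> unit_itv_hausdorff)).
Qed.

Lemma hilbert_cube_infinite (E : set Q) : finite_set E -> exists y, ~ E y.
Proof.
move=> fE; have [t [t01 tE]] := itv_avoid_finite ltr01 (finite_image (coord 0) fE).
exists (of_coords (fun=> t)) => Ey; apply: tE; exists (of_coords (fun=> t)) => //.
by rewrite coord_of_coords//; lra.
Qed.

Definition pseudo_interior : set Q := [set z | forall n, 0 < coord n z < 1].

(** The product over [d] in [D] of the distances to [d] in a coordinate of [C] where
    [d] differs from [x], normalized at [x]. *)
Lemma separating_function (C : set nat) x (D : set Q) : finite_set D ->
  (forall d, D d -> exists2 n, C n & x n <> d n) ->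
  exists s : Q -> R, [/\ continuous s,
    forall z z', (forall n, C n -> z n = z' n) -> s z = s z',
    s x = 1 & forall d, D d -> s d = 0].
Proof.
move=> /finite_seqP[l ->]; elim: l => [|d l IHl] xD.
  by exists (fun=> 1); split=> //; exact: cst_continuous.
have [e el|s [cs sC sx sl]] := IHl.
  by apply: xD; rewrite /= inE el orbT.
have [|n Cn xdn] := xD d; first by rewrite /= inE eqxx.
have xd0 : `|coord n x - coord n d| != 0.
  by rewrite normr_eq0 subr_eq0; apply/eqP => /to_real_inj.
exists (fun z => s z * (`|coord n z - coord n d| / `|coord n x - coord n d|)).
split.
- have cK (a : R) : continuous (fun _ : Q => a) by exact: cst_continuous.
  have cn : continuous (fun z => `|coord n z - coord n d|).
    have cd : continuous (fun z => coord n z - coord n d).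
      exact: (continuous_sub (@coord_continuous n) (cK _)).
    by move=> z; exact: (cvg_norm (cd z)).
  exact: (continuous_mul cs (continuous_mul cn (cK _))).
- by move=> z z' zz'; rewrite (sC z z')// /coord zz'.
- by rewrite sx divff// mulr1.
- move=> e /=; rewrite inE => /predU1P[->|el].
    by rewrite subrr normr0 mul0r mulr0.
  by rewrite sl// mul0r.
Qed.

(** The coordinates where [x] and [y] agree are left fixed and control the motion of
    the others: the [n]-th coordinate moves by [scale_odds (s z * L n)], where [s]
    depends only on the fixed coordinates, so the inverse is obtained by changing
    the sign of the parameter. *)
Lemma slide (D : set Q) x y : finite_set D ->
  pseudo_interior x -> pseudo_interior y ->
  (forall d, D d -> exists2 n, x n = y n & x n <> d n) ->
  exists2 k : homeo Q, pointwise_stab D k & k x = y.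
Proof.
move=> fD ix iy xyD.
have [s [cs sC sx sD]] := separating_function fD xyD.
pose L n := logit (coord n y) - logit (coord n x).
pose f (e : R) z := of_coords (fun n => scale_odds (e * s z * L n) (coord n z)).
have fE e z n : coord n (f e z) = scale_odds (e * s z * L n) (coord n z).
  by rewrite coord_of_coords// scale_odds_itv// coord_itv.
have sf e z : s (f e z) = s z.
  apply: sC => n xyn; apply: to_real_inj; have := fE e z n.
  by rewrite /L /coord xyn subrr mulr0 scale_odds0.
have fK e : cancel (f e) (f (- e)).
  move=> z; apply: coord_ext => n; rewrite !fE sf !mulNr scale_oddsK//.
  exact: coord_itv.
have cK (a : R) : continuous (fun _ : Q => a) by exact: cst_continuous.
have cf e : continuous (f e).
  apply: continuous_hilbert_cube => n.
  have <- : (fun t => scale_odds (e * s t * L n) (coord n t)) =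
      (fun t => coord n (f e t)) by apply/funext => t; exact/esym/fE.
  have cu := continuous_mul (continuous_mul (cK e) cs) (cK (L n)).
  move=> z; apply: cvg_scale_odds (coord_itv n z) (cu z) _.
  exact: coord_continuous.
have hf : homeomorphism (f 1).
  split=> //; exists (f (- 1)); split=> //.
  by rewrite -{2}[1]opprK.
exists (Homeo hf) => [d Dd|] /=; apply: coord_ext => n; rewrite fE.
  by rewrite sD// mulr0 mul0r scale_odds0.
by rewrite sx mulr1 mul1r scale_odds_logit.
Qed.

Lemma distinguishing_bound (D : set Q) x : finite_set D -> ~ D x ->
  exists m, forall d, D d -> exists2 n, (n < m)%N & x n <> d n.
Proof.
move=> /finite_seqP[l ->]; elim: l => [|d l IHl] xD; first by exists 0.
have [|m ml] := IHl; first by move=> xl; apply: xD; rewrite /= inE xl orbT.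
have [n xdn] : exists n, x n <> d n.
  apply/existsNP => xd; apply: xD; rewrite /= inE; apply/orP; left; apply/eqP.
  exact/funext.
exists (maxn m n.+1) => e; rewrite /= inE => /predU1P[->|/ml[k km xek]].
  by exists n => //; rewrite leq_max ltnSn orbT.
by exists k => //; rewrite leq_max km.
Qed.

(** Let [m] be the index of a coordinate beyond those needed to distinguish [x] and
    [y] from the points of [D], and let [a] be a value that no point of [D] takes
    there.  Each of the three steps from [x] to [x] with [a] at [m], to [y] with [a]
    at [m], to [y] keeps coordinates that distinguish the point from [D]. *)
Lemma pseudo_interior_homogeneous (D : set Q) x y : finite_set D ->
  pseudo_interior x -> pseudo_interior y -> ~ D x -> ~ D y ->
  exists2 k : homeo Q, pointwise_stab D k & k x = y.
Proof.
move=> fD ix iy Dx Dy.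
have [m1 m1P] := distinguishing_bound fD Dx.
have [m2 m2P] := distinguishing_bound fD Dy.
pose m := maxn m1 m2.
have [a [a01 aD]] := itv_avoid_finite ltr01 (finite_image (coord m) fD).
have a01' : 0 <= a <= 1 by lra.
pose upd z : Q := fun n => if n == m then to_unit a else z n.
have updm z : upd z m = to_unit a by rewrite /upd eqxx.
have updn z n : n != m -> upd z n = z n by move=> nm; rewrite /upd (negbTE nm).
have iupd z : pseudo_interior z -> pseudo_interior (upd z).
  move=> iz n; have [->|nm] := eqVneq n m; last first.
    by rewrite /coord updn//; exact: iz.
  by rewrite /coord updm to_unitK.
have aDm d : D d -> to_unit a <> d m.
  by move=> Dd ad; apply: aD; exists d => //; rewrite /coord -ad to_unitK.
have [k1 Dk1 k1x] : exists2 k : homeo Q, pointwise_stab D k & k x = upd x.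
  apply: slide => //; first exact: iupd.
  move=> d /m1P[n nm xn]; exists n => //; rewrite updn//.
  by rewrite neq_ltn (leq_trans nm)// leq_maxl.
have [k2 Dk2 k2x] : exists2 k : homeo Q, pointwise_stab D k & k (upd x) = upd y.
  apply: slide => //; [exact: iupd|exact: iupd|].
  by move=> d /aDm ad; exists m; rewrite ?updm.
have [k3 Dk3 k3y] : exists2 k : homeo Q, pointwise_stab D k & k y = upd y.
  apply: slide => //; first exact: iupd.
  move=> d /m2P[n nm yn]; exists n => //; rewrite updn//.
  by rewrite neq_ltn (leq_trans nm)// leq_maxr.
exists (k3^-1 * k2 * k1)%g.
  apply: pointwise_stabM => //; apply: pointwise_stabM => //.
  exact: pointwise_stabV.
by rewrite !homeoM k1x k2x -k3y homeoK.
Qed.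

(** The value that the coordinate [n] holds after the turns of the squares formed by
    the coordinates [0, 1], ..., [n - 1, n]. *)
Fixpoint carry z n : R :=
  if n is n'.+1 then turn2 (carry z n') (coord n z) else coord 0 z.

(** The infinite composition of the turns of the squares formed by the coordinates
    [n, n + 1], in increasing order of [n].  The coordinate [n] is no longer changed
    after the turn in the square [n, n + 1]. *)
Definition push z : Q := of_coords (fun n => turn1 (carry z n) (coord n.+1 z)).

Lemma carry_itv z n : 0 <= carry z n <= 1.
Proof.
elim: n => [|n IHn]; first exact: coord_itv.
by case: (turn_itv IHn (coord_itv n.+1 z)).
Qed.

Lemma coord_push z n : coord n (push z) = turn1 (carry z n) (coord n.+1 z).
Proof.
by rewrite coord_of_coords//; case: (turn_itv (carry_itv z n) (coord_itv n.+1 z)).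
Qed.

Lemma push_continuous : continuous push.
Proof.
have cc n : continuous (carry ^~ n).
  elim: n => [|n IHn]; first exact: coord_continuous.
  by have [] := continuous_turn IHn (@coord_continuous n.+1).
apply: continuous_hilbert_cube => n.
have <- : (fun z => turn1 (carry z n) (coord n.+1 z)) =
    (fun z => coord n (push z)) by apply/funext => z; rewrite coord_push.
by have [] := continuous_turn (cc n) (@coord_continuous n.+1).
Qed.

Lemma unturn_push z n : unturn1 (coord n (push z)) (carry z n.+1) = carry z n /\
  unturn2 (coord n (push z)) (carry z n.+1) = coord n.+1 z.
Proof. by rewrite coord_push; apply: turnK; [exact: carry_itv|exact: coord_itv]. Qed.

(** By [unturn_push] and [unturn1_contract] the distance between the values carried
    at [n] is at most half the distance between those carried at [n + 1], hence at
    most [2^-1 ^+ k] for every [k]. *)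
Lemma push_inj : injective push.
Proof.
move=> z z' zz'.
have step n k : `|carry z n - carry z' n| <= 2^-1 ^+ k.
  elim: k n => [|k IHk] n.
    have := carry_itv z n; have := carry_itv z' n.
    by rewrite expr0 ler_norml; lra.
  have [<- _] := unturn_push z n; have [<- _] := unturn_push z' n.
  rewrite -zz'; apply: le_trans (unturn1_contract _ _ _) _.
  by rewrite exprS mulrC ler_wpM2l// invr_ge0.
have carryE n : carry z n = carry z' n.
  apply/eqP; rewrite -subr_eq0 -normr_le0.
  have half_lt1 : `|2^-1| < 1 :> R by rewrite ger0_norm ?invr_ge0// invf_lt1 ?ltr1n.
  by apply: (cvgr_to_ge (cvg_expr half_lt1)); exact: nearW.
apply: coord_ext => -[|n]; first exact: (carryE 0).
have [_ <-] := unturn_push z n; have [_ <-] := unturn_push z' n.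
by rewrite zz' carryE.
Qed.

(** The value carried at [n] when the value carried at [n + j] is 0 and the coordinates
    of the image are those of [w]. *)
Fixpoint uncarry (w : Q) n j : R :=
  if j is j'.+1 then unturn1 (coord n w) (uncarry w n.+1 j') else 0.

Lemma uncarry_itv w n j : 0 <= uncarry w n j <= 1.
Proof.
elim: j n => [|j IHj] n /=; first by rewrite lexx ler01.
by case: (unturn_itv (coord_itv n w) (IHj n.+1)).
Qed.

(** Undoing finitely many turns gives preimages up to any finite number of
    coordinates; [push_surj] then follows by compactness. *)
Lemma push_approx (w : Q) m :
  exists z, forall n, (n < m)%N -> coord n (push z) = coord n w.
Proof.
pose z := of_coords (fun n => if n is n'.+1
  then unturn2 (coord n' w) (uncarry w n (m - n)) else uncarry w 0 m).
have z0 : coord 0 z = uncarry w 0 m.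
  by rewrite coord_of_coords ?uncarry_itv.
have zS n : coord n.+1 z = unturn2 (coord n w) (uncarry w n.+1 (m - n.+1)).
  rewrite coord_of_coords//.
  by case: (unturn_itv (coord_itv n w) (uncarry_itv w n.+1 (m - n.+1))).
have unturnw n : (n < m)%N -> uncarry w n (m - n) =
    unturn1 (coord n w) (uncarry w n.+1 (m - n.+1)).
  by move=> nm; rewrite subnS -[in LHS](@prednK (m - n)) ?subn_gt0.
have turnw n := unturnK (coord_itv n w) (uncarry_itv w n.+1 (m - n.+1)).
have carryz n : (n <= m)%N -> carry z n = uncarry w n (m - n).
  elim: n => [|n IHn] nm /=; first by rewrite z0 subn0.
  by rewrite IHn 1?ltnW// zS unturnw// (turnw n).2.
exists z => n nm; rewrite coord_push carryz 1?ltnW// zS unturnw//.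
exact: (turnw n).1.
Qed.

Lemma push_surj w : exists z, push z = w.
Proof.
have [s sw] := choice (push_approx w).
have closed_push : closed (range push).
  apply: compact_closed; first exact: hilbert_cube_hausdorff.
  apply: continuous_compact; last exact: hilbert_cube_compact.
  by apply: continuous_subspaceT => z; exact: push_continuous.
have sw_cvg : (fun m => push (s m)) @ \oo --> w.
  apply: cvg_hilbert_cube => n; apply: cvg_near_cst.
  by exists n.+1 => // m /= nm; exact: sw.
have near_range : \forall m \near \oo, range push (push (s m)).
  by apply: nearW => m; exists (s m).
by have [z _ <-] := closed_cvg _ closed_push near_range _ sw_cvg; exists z.
Qed.

Lemma push_pseudo_interior z : pseudo_interior z -> pseudo_interior (push z).
Proof.
move=> iz; have ic n : 0 < carry z n < 1.
  by elim: n => [|n IHn] //=; case: (turn_oitv IHn (iz n.+1)).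
by move=> n; rewrite coord_push; case: (turn_oitv (ic n) (iz n.+1)).
Qed.

Lemma push_into_pseudo_interior z : (forall n, coord n z <= 2^-1) ->
  pseudo_interior (push z).
Proof.
move=> z2; have z0 n : 0 <= coord n z by case/andP: (coord_itv n z).
have ic n : 0 <= carry z n < 1.
  elim: n => [|n IHn] /=; last by case: (turn_away IHn (z0 n.+1) (z2 n.+1)).
  by rewrite z0 (le_lt_trans (z2 0)) ?invf_lt1 ?ltr1n.
by move=> n; rewrite coord_push; case: (turn_away (ic n) (z0 n.+1) (z2 n.+1)).
Qed.

(** Reflecting some of the coordinates prepares the point for
    [push_into_pseudo_interior]. *)
Lemma flip_to_lower_half x : exists h : homeo Q,
  (forall n, coord n (h x) <= 2^-1) /\
  forall z, pseudo_interior z -> pseudo_interior (h z).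
Proof.
pose f z := of_coords (fun n =>
  if coord n x <= 2^-1 then coord n z else 1 - coord n z).
have fE z n : coord n (f z) = if coord n x <= 2^-1 then coord n z else 1 - coord n z.
  by rewrite coord_of_coords//; case: ifP => _; have := coord_itv n z; lra.
have fK : involutive f.
  by move=> z; apply: coord_ext => n; rewrite !fE; case: ifP => -> //; rewrite subKr.
have cf : continuous f.
  apply: continuous_hilbert_cube => n.
  have -> : (fun t => coord n (f t)) = if coord n x <= 2^-1 then coord n
      else (fun t => 1 - coord n t).
    by apply/funext => t; rewrite fE; case: ifP.
  case: ifP => _; first exact: coord_continuous.
  have cK (a : R) : continuous (fun _ : Q => a) by exact: cst_continuous.
  exact: (continuous_sub (cK 1) (@coord_continuous n)).
have hf : homeomorphism f by split=> //; exists f.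
exists (Homeo hf); split=> [n|z iz n] /=; rewrite fE.
  by case: (leP (coord n x) 2^-1) => // ?; lra.
by case: ifP => // _; have := iz n; lra.
Qed.

Lemma to_pseudo_interior x : exists h : homeo Q, pseudo_interior (h x) /\
  forall z, pseudo_interior z -> pseudo_interior (h z).
Proof.
have [f [fx fi]] := flip_to_lower_half x.
have [p pE] := compact_bijection_homeo hilbert_cube_compact
  hilbert_cube_hausdorff push_continuous push_inj push_surj.
exists (p * f)%g; split=> [|z iz]; rewrite homeoM pE.
  exact: push_into_pseudo_interior.
by apply: push_pseudo_interior; exact: fi.
Qed.

Lemma hilbert_cube_homogeneous : finitely_homogeneous Q.
Proof.
move=> D x y fD Dx Dy.
have [f [fx fi]] := to_pseudo_interior x.
have [g [gfy gi]] := to_pseudo_interior (f y).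
pose h := (g * f)%g.
have nD z : ~ D z -> ~ (h @` D) (h z).
  by move=> nDz [w Dw /homeo_inj wz]; apply: nDz; rewrite -wz.
have [k Dk kx] := pseudo_interior_homogeneous (finite_image h fD)
  (gi _ fx : pseudo_interior (h x)) (gfy : pseudo_interior (h y)) (nD _ Dx) (nD _ Dy).
exists (h^-1 * k * h)%g; first exact: pointwise_stab_conj.
by rewrite !homeoM kx homeoK.
Qed.

(** Homeomorphisms that fix the coordinates below [n] tend to 1 as [n] grows.  On the
    other coordinates, which form a Hilbert cube, the projections of [F] can be moved
    off those of [E]. *)
Lemma hilbert_cube_displaceable : finitely_displaceable Q.
Proof.
move=> A F E A1 fF fE.
pose tail n z : Q := fun i => z (n + i)%N.
pose N n : set (homeo Q) := [set h | forall z i, (i < n)%N -> (h z) i = z i].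
pose G := filter_from [set: nat] N.
have FG : Filter G.
  apply: filter_from_filter; first by exists 0.
  move=> i j _ _; exists (maxn i j) => // h hij.
  by split=> z k ki; apply: hij; rewrite leq_max ki ?orbT.
have G1 : G --> ((1%g : homeo Q) : Topological.Pack (tau_k Q)).
  apply/(tau_k_cvgP hilbert_cube_compact hilbert_cube_hausdorff _ FG) => x.
  apply: cvg_hilbert_cube => n B /= Bx.
  exists (coord n @^-1` B, N n.+1) => /=.
    by split; [exact: coord_continuous|exists n.+1].
  by move=> [z h] /= [Bz hn]; rewrite /coord hn.
have [n _ NA] := G1 _ A1.
have [k kFE] := homogeneous_disjoint hilbert_cube_homogeneous
  hilbert_cube_infinite (finite_image (tail n) fF) (finite_image (tail n) fE).
pose f (l : homeo Q) z : Q :=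
  fun i => if (i < n)%N then z i else l (tail n z) (i - n)%N.
have tailf l z : tail n (f l z) = l (tail n z).
  by apply/funext => i; rewrite /tail /f ltnNge leq_addr/= addKn.
have fK (l l' : homeo Q) : cancel l l' -> cancel (f l) (f l').
  move=> ll' z; apply/funext => i; rewrite {1}/f tailf ll' /f.
  by case: ltnP => // ni; rewrite /tail subnKC.
have cf l : continuous (f l).
  have ct : continuous (tail n).
    by apply: continuous_hilbert_cube => i; exact: (@coord_continuous (n + i)).
  apply: continuous_hilbert_cube => i; have [ni|ni] := ltnP i n.
    have -> : (fun z => coord i (f l z)) = coord i.
      by apply/funext => z; rewrite /coord /f ni.
    exact: coord_continuous.
  have -> : (fun z => coord i (f l z)) = (fun z => coord (i - n) (l (tail n z))).
    by apply/funext => z; rewrite /coord /f ltnNge ni.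
  move=> z; apply: (@continuous_comp Q Q _ (fun z => l (tail n z))
    (coord (i - n))); last exact: coord_continuous.
  apply: (@continuous_comp Q Q Q (tail n) l); first exact: ct.
  exact: homeo_continuous.
have hf : homeomorphism (f k).
  split; first exact: cf.
  exists (f (k^-1)%g); split; [exact: cf|exact/fK/homeoK|exact/fK/homeoVK].
exists (Homeo hf) => [|x Fx Ex]; first by apply: NA => z i /= ni; rewrite /f ni.
apply: (kFE (tail n x)); first by exists x.
by rewrite -tailf; exists (f k x).
Qed.

End hilbert_cube.

(** * Group topologies coarser than the pointwise and compact-open ones *)

Theorem corollary2 (R : realType) (X : topologicalType)
    (hX : (exists2 n : nat, (2 <= n)%N & compact_manifold R n X) \/
          homeomorphic X cantor_space \/
          homeomorphic X (hilbert_cube R)) :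
  (forall t : Topological (homeo X),
     (is_group_topology t /\
      opens t `<=` opens (tau_p X) /\
      opens t `<=` opens (tau_k X)) <->
     is_indiscrete t) /\
  ~ (exists t : Topological (homeo X), is_minimum_hausdorff_group_topology t).
Proof.
have [homX dispX cX sepX X0] : [/\ finitely_homogeneous X,
    finitely_displaceable X, compact [set: X], hausdorff_space X &
    [set: X] !=set0].
  case: hX => [[[|[|n]] // _ mX]|[]].
  - have [X0 _ cX [sepX _] _] := mX.
    by split=> //; [exact: manifold_homogeneous mX|exact: manifold_displaceable mX].
  - move=> [f [cf [g [cg fK gK]]]]; split.
    + exact: transport_homogeneous fK gK cantor_homogeneous.
    + exact: transport_displaceable cantor_space_compact cantor_space_hausdorff
        cantor_displaceable.
    + exact: transport_compact cantor_space_compact.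
    + exact: transport_hausdorff cantor_space_hausdorff.
    + by exists (g (fun=> true)).
  - move=> [f [cf [g [cg fK gK]]]]; split.
    + exact: transport_homogeneous fK gK hilbert_cube_homogeneous.
    + exact: transport_displaceable hilbert_cube_compact hilbert_cube_hausdorff
        hilbert_cube_displaceable.
    + exact: transport_compact hilbert_cube_compact.
    + exact: transport_hausdorff hilbert_cube_hausdorff.
    + by exists (g (of_coords (fun=> 0))).
split; first exact: indiscreteP.
exact: no_minimum_hausdorff_group_topology.
Qed.
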